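(* Let $0\to(\mathfrak u,\mathfrak r,\mu)\to(\mathfrak m,\mathfrak f,\mu)\to(\mathfrak n,\mathfrak q,\delta)\to0$ be a free presentation of a Leibniz crossed module $(\mathfrak n,\mathfrak q,\delta)$, let $(\bar{\mathfrak u},\bar{\mathfrak r},\bar\mu)=\dfrac{(\mathfrak u,\mathfrak r,\mu)}{[(\mathfrak u,\mathfrak r,\mu),(\mathfrak m,\mathfrak f,\mu)]}$, and regard $\mathcal M(\mathfrak n,\mathfrak q,\delta)=\dfrac{(\mathfrak u,\mathfrak r,\mu)\cap[(\mathfrak m,\mathfrak f,\mu),(\mathfrak m,\mathfrak f,\mu)]}{[(\mathfrak u,\mathfrak r,\mu),(\mathfrak m,\mathfrak f,\mu)]}$ as contained in $(\bar{\mathfrak u},\bar{\mathfrak r},\bar\mu)$. For a crossed ideal $(\mathfrak t,\mathfrak s,\mu)$ of $(\mathfrak m,\mathfrak f,\mu)$ with $[(\mathfrak u,\mathfrak r,\mu),(\mathfrak m,\mathfrak f,\mu)]\subseteq(\mathfrak t,\mathfrak s,\mu)\subseteq(\mathfrak u,\mathfrak r,\mu)$, write $(\bar{\mathfrak t},\bar{\mathfrak s},\bar\mu)=\dfrac{(\mathfrak t,\mathfrak s,\mu)}{[(\mathfrak u,\mathfrak r,\mu),(\mathfrak m,\mathfrak f,\mu)]}$. (i) If $(\bar{\mathfrak u},\bar{\mathfrak r},\bar\mu)=\mathcal M(\mathfrak n,\mathfrak q,\delta)\oplus(\bar{\mathfrak t},\bar{\mathfrak s},\bar\mu)$ for some such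 crossed ideal $(\mathfrak t,\mathfrak s,\mu)$ of $(\mathfrak m,\mathfrak f,\mu)$, then the extension $0\to(\mathfrak u/\mathfrak t,\mathfrak r/\mathfrak s,\bar\mu)\to(\mathfrak m/\mathfrak t,\mathfrak f/\mathfrak s,\bar\mu)\to(\mathfrak n,\mathfrak q,\delta)\to0$ is a stem cover of $(\mathfrak n,\mathfrak q,\delta)$. (ii) If $\mathcal M(\mathfrak n,\mathfrak q,\delta)$ is finite dimensional and $0\to(\mathfrak a,\mathfrak b,\sigma)\to(\mathfrak h,\mathfrak p,\sigma)\to(\mathfrak n,\mathfrak q,\delta)\to0$ is a stem cover of $(\mathfrak n,\mathfrak q,\delta)$, then there is a crossed ideal $(\mathfrak t,\mathfrak s,\mu)$ of $(\mathfrak m,\mathfrak f,\mu)$, with $[(\mathfrak u,\mathfrak r,\mu),(\mathfrak m,\mathfrak f,\mu)]\subseteq(\mathfrak t,\mathfrak s,\mu)\subseteq(\mathfrak u,\mathfrak r,\mu)$, such that $(\bar{\mathfrak u},\bar{\mathfrak r},\bar\mu)=\mathcal M(\mathfrak n,\mathfrak q,\delta)\oplus(\bar{\mathfrak t},\bar{\mathfrak s},\bar\mu)$, $(\mathfrak h,\mathfrak p,\sigma)\cong(\mathfrak m/\mathfrak t,\mathfrak f/\mathfrak s,\bar\mu)$ and $(\mathfrak a,\mathfrak b,\sigma)\cong(\mathfrak u/\mathfrak t,\mathfrak r/\mathfrak s,\bar\mu)$.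
   Context: Fix a field $\mathbb K$. A Leibniz algebra is a $\mathbb K$-vector space $\mathfrak q$ with a bilinear bracket satisfying $[x,[y,z]]=[[x,y],z]-[[x,z],y]$. A Leibniz action of $\mathfrak m$ on $\mathfrak n$ is a pair of bilinear maps $(m,n)\mapsto{}^{m}n$, $(n,m)\mapsto n^{m}$ with values in $\mathfrak n$ such that ${}^{[m,m']}n={}^{m}({}^{m'}n)+({}^{m}n)^{m'}$, ${}^{m}[n,n']=[{}^{m}n,n']-[{}^{m}n',n]$, $n^{[m,m']}=(n^{m})^{m'}-(n^{m'})^{m}$, $[n,n']^{m}=[n^{m},n']+[n,n'^{m}]$, ${}^{m}({}^{m'}n)=-{}^{m}(n^{m'})$, $[n,{}^{m}n']=-[n,n'^{m}]$. A Leibniz crossed module $(\mathfrak n,\mathfrak q,\delta)$ is a homomorphism $\delta:\mathfrak n\to\mathfrak q$ of Leibniz algebras with a Leibniz action of $\mathfrak q$ on $\mathfrak n$ such that $\delta({}^{q}n)=[q,\delta(n)]$, $\delta(n^{q})=[\delta(n),q]$, ${}^{\delta(n_1)}n_2=[n_1,n_2]=n_1^{\delta(n_2)}$. A homomorphism $(\varphi,\psi):(\mathfrak n,\mathfrak q,\delta)\to(\mathfrak n',\mathfrak q',\delta')$ is a pair of Leibniz homomorphisms with $\psi\delta=\delta'\varphi$, $\varphi({}^{q}n)={}^{\psi(q)}\varphi(n)$, $\varphi(n^{q})=\varphi(n)^{\psi(q)}$. The category is $\mathbf{XLb}$; kernels, quotients, intersections, direct sums, inclusions, surjectivity and exactness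 are componentwise. $(\mathfrak n,\mathfrak q,\delta)$ is finite dimensional if $\mathfrak n$ and $\mathfrak q$ are. Crossed ideals are normal subobjects, i.e. kernels of homomorphisms. Commutators: for crossed ideals $(\mathfrak s,\mathfrak h,\delta)$, $(\mathfrak t,\mathfrak j,\delta)$ of $(\mathfrak n,\mathfrak q,\delta)$, $[(\mathfrak s,\mathfrak h,\delta),(\mathfrak t,\mathfrak j,\delta)]=(\langle D_{\mathfrak h}(\mathfrak t),D_{\mathfrak j}(\mathfrak s)\rangle,[\mathfrak h,\mathfrak j],\delta|)$, where $D_{\mathfrak h}(\mathfrak t)=\{{}^{h}t,t^{h}\mid h\in\mathfrak h,t\in\mathfrak t\}$, similarly $D_{\mathfrak j}(\mathfrak s)$, and $[\mathfrak h,\mathfrak j]$ is generated by all $[x,y],[y,x]$, $x\in\mathfrak h,y\in\mathfrak j$. Free presentations: for a set $X$, let $F(X)$ be the free Leibniz algebra on $X$, $F(X)*F(X)$ the coproduct of Leibniz algebras with inclusions $i_1,i_2$, and $\overline{F(X)}$ the kernel of $p_2:F(X)*F(X)\to F(X)$ with $p_2i_1=0$, $p_2i_2={\sf id}$. The free Leibniz crossed module on $X$ is the inclusion crossed module $(\overline{F(X)},F(X)*F(X),inc)$ (action by bracket); it is projective in $\mathbf{XLb}$ with respect to surjective homomorphisms. A free (resp. projective) presentation of $(\mathfrak n,\mathfrak q,\delta)$ is a short exact sequence $0\to(\mathfrak u,\mathfrak r,\mu)\to(\mathfrak m,\mathfrak f,\mu)\to(\mathfrak n,\mathfrak q,\delta)\to0$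 with $(\mathfrak m,\mathfrak f,\mu)$ free (resp. projective). The Schur multiplier $\mathcal M(\mathfrak n,\mathfrak q,\delta)$, given by the quotient displayed in the claim, is independent of the projective presentation up to isomorphism. An extension $0\to(\mathfrak a,\mathfrak b,\sigma)\to(\mathfrak h,\mathfrak p,\sigma)\to(\mathfrak n,\mathfrak q,\delta)\to0$ is central if $[(\mathfrak a,\mathfrak b,\sigma),(\mathfrak h,\mathfrak p,\sigma)]=0$; a central extension is a stem extension if $(\mathfrak a,\mathfrak b,\sigma)\subseteq[(\mathfrak h,\mathfrak p,\sigma),(\mathfrak h,\mathfrak p,\sigma)]$, and a stem cover if moreover $(\mathfrak a,\mathfrak b,\sigma)\cong\mathcal M(\mathfrak n,\mathfrak q,\delta)$. *)

(* Defs.v *)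
(* Vector spaces are possibly infinite-dimensional. Subspaces are boolean
   predicates, so that MathComp's subtypes and quotients apply to them; boolp
   turns Prop-valued predicates into boolean ones. *)
From HB Require Import structures.
From mathcomp Require Import all_boot all_order all_algebra.
From mathcomp Require Import boolp.

Set Implicit Arguments.
Unset Strict Implicit.
Unset Printing Implicit Defensive.
Import GRing.Theory.
Local Open Scope ring_scope.
Local Open Scope quotient_scope.

Record subspace (K : fieldType) (V : lmodType K) := Subspace {
  subspace_pred :> {pred V};
  subspace_closed : submod_closed subspace_pred
}.

HB.instance Definition _ (K : fieldType) (V : lmodType K) (S : subspace V) :=
  GRing.isSubmodClosed.Build K V (subspace_pred S) (subspace_closed S).

Lemma subspace_of_closed (K : fieldType) (V : lmodType K) (P : V -> Prop) :
  P 0 -> (forall a u v, P u -> P v -> P (a *: u + v)) ->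
  submod_closed (fun x => `[< P x >]).
Proof.
move=> P0 PD; split=> [|a u v /asboolP Pu /asboolP Pv]; first exact/asboolP.
exact/asboolP/PD.
Qed.

Definition subspace_of (K : fieldType) (V : lmodType K) (P : V -> Prop)
    (P0 : P 0) (PD : forall a u v, P u -> P v -> P (a *: u + v)) : subspace V :=
  Subspace (subspace_of_closed P0 PD).

Lemma subspace_ofP (K : fieldType) (V : lmodType K) (P : V -> Prop) P0 PD x :
  (x \in @subspace_of K V P P0 PD) <-> P x.
Proof. by split=> [/asboolP|Px] //; apply/asboolP. Qed.

Definition fullspace (K : fieldType) (V : lmodType K) : subspace V :=
  @Subspace K V predT (conj isT (fun _ _ _ _ _ => isT)).

Section SubspaceConstructions.
Variables (K : fieldType) (V W : lmodType K).

Lemma capspace_closed (S T : subspace V) :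
  submod_closed (fun x => (x \in S) && (x \in T)).
Proof.
split=> [|a u v /andP[Su Tu] /andP[Sv Tv]]; apply/andP.
  by rewrite !rpred0.
by rewrite !rpredD ?rpredZ.
Qed.
Definition capspace (S T : subspace V) : subspace V :=
  Subspace (capspace_closed S T).

Lemma in_capspace S T x : (x \in capspace S T) = (x \in S) && (x \in T).
Proof. by []. Qed.

(* the smallest subspace containing D *)
Definition in_span (D : V -> Prop) (x : V) : Prop :=
  forall S : subspace V, (forall y, D y -> y \in S) -> x \in S.

Lemma in_span0 D : in_span D 0.
Proof. by move=> S _; apply: rpred0. Qed.
Lemma in_spanD D a u v : in_span D u -> in_span D v -> in_span D (a *: u + v).
Proof. by move=> Du Dv S DS; rewrite rpredD ?rpredZ ?Du ?Dv. Qed.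
Definition spanspace (D : V -> Prop) : subspace V :=
  subspace_of (@in_span0 D) (@in_spanD D).

Lemma mem_spanspace (D : V -> Prop) x : D x -> x \in spanspace D.
Proof. by move=> Dx; apply/subspace_ofP => S; apply. Qed.

Lemma spanspace_min (D : V -> Prop) (S : subspace V) :
  (forall x, D x -> x \in S) -> forall x, x \in spanspace D -> x \in S.
Proof. by move=> DS x /subspace_ofP/(_ S DS). Qed.

Lemma span_preimage (D : V -> Prop) (S : subspace W) (f : V -> W) :
    linear f -> (forall x, D x -> f x \in S) ->
  forall x, x \in spanspace D -> f x \in S.
Proof.
move=> f_lin DS x Dx.
have f0 : f 0 \in S.
  have := f_lin (-1) 0 0; rewrite scaler0 addr0 scaleN1r addNr => ->.
  exact: rpred0.
have fD a u v : f u \in S -> f v \in S -> f (a *: u + v) \in S.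
  by move=> Su Sv; rewrite f_lin rpredD ?rpredZ.
apply/(@subspace_ofP K V (fun x => f x \in S) f0 fD).
by apply: spanspace_min Dx => y Dy; apply/subspace_ofP/DS.
Qed.

Lemma kerspace_closed (f : {linear V -> W}) : submod_closed (fun x => f x == 0).
Proof.
split=> [|a u v /eqP fu /eqP fv]; apply/eqP; first by rewrite linear0.
by rewrite linearP fu fv scaler0 addr0.
Qed.
Definition kerspace (f : {linear V -> W}) : subspace V :=
  Subspace (kerspace_closed f).

Lemma in_kerspace f x : (x \in kerspace f) = (f x == 0).
Proof. by []. Qed.

Definition in_image (f : {linear V -> W}) (S : subspace V) (y : W) : Prop :=
  exists2 x, x \in S & f x = y.

Lemma in_image0 f S : in_image f S 0.
Proof. by exists 0; rewrite ?rpred0 ?linear0. Qed.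
Lemma in_imageD f S a u v :
  in_image f S u -> in_image f S v -> in_image f S (a *: u + v).
Proof.
move=> [x Sx <-] [y Sy <-]; exists (a *: x + y); last by rewrite linearP.
by rewrite rpredD ?rpredZ.
Qed.
Definition imspace (f : {linear V -> W}) (S : subspace V) : subspace W :=
  subspace_of (in_image0 f S) (@in_imageD f S).

Lemma in_imspace f S y : (y \in imspace f S) <-> exists2 x, x \in S & f x = y.
Proof. exact: subspace_ofP. Qed.

End SubspaceConstructions.

Section SubAndQuotientSpaces.
Variables (K : fieldType) (V : lmodType K) (S : subspace V).

Definition sub_mod := {x : V | x \in S}.
HB.instance Definition _ := SubChoice.on sub_mod.
HB.instance Definition _ := [SubChoice_isSubZmodule of sub_mod by <:].
HB.instance Definition _ := [SubZmodule_isSubLmodule of sub_mod by <:].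

Definition quot_mod := Quotient.quot S.
HB.instance Definition _ := Choice.on quot_mod.
HB.instance Definition _ := GRing.Zmodule.on quot_mod.

Definition quot_pi (x : V) : quot_mod := \pi_(Quotient.quot S) x.
Definition quot_repr (x : quot_mod) : V := repr (x : Quotient.quot S).

Lemma quot_reprK : cancel quot_repr quot_pi.
Proof. exact: reprK. Qed.

Lemma eq_quot_pi x y : (quot_pi x == quot_pi y) = (x - y \in S).
Proof. exact/esym/Quotient.idealrBE. Qed.

Lemma quot_repr_pi x : quot_repr (quot_pi x) - x \in S.
Proof. by rewrite -eq_quot_pi quot_reprK. Qed.

Lemma quot_pi_is_zmod_morphism : zmod_morphism quot_pi.
Proof. by move=> x y; rewrite /quot_pi raddfB. Qed.
HB.instance Definition _ :=
  GRing.isZmodMorphism.Build V quot_mod quot_pi quot_pi_is_zmod_morphism.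

Definition quot_scale (a : K) (x : quot_mod) := quot_pi (a *: quot_repr x).

Lemma quot_scale_pi a x : quot_scale a (quot_pi x) = quot_pi (a *: x).
Proof.
by apply/eqP; rewrite eq_quot_pi -scalerBr rpredZ // quot_repr_pi.
Qed.

Lemma quot_scaleA a b x : quot_scale a (quot_scale b x) = quot_scale (a * b) x.
Proof. by rewrite -[x]quot_reprK !quot_scale_pi scalerA. Qed.
Lemma quot_scale1 : left_id 1 quot_scale.
Proof. by move=> x; rewrite -[x]quot_reprK quot_scale_pi scale1r. Qed.
Lemma quot_scaleDr : right_distributive quot_scale +%R.
Proof.
move=> a x y; rewrite -[x]quot_reprK -[y]quot_reprK -raddfD !quot_scale_pi.
by rewrite scalerDr raddfD.
Qed.
Lemma quot_scaleDl x : {morph quot_scale^~ x : a b / a + b}.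
Proof.
by move=> a b; rewrite -[x]quot_reprK !quot_scale_pi scalerDl raddfD.
Qed.
HB.instance Definition _ := GRing.Zmodule_isLmodule.Build K quot_mod
  quot_scaleA quot_scale1 quot_scaleDr quot_scaleDl.

Lemma quot_pi_is_scalable : scalable quot_pi.
Proof. by move=> a x; rewrite -quot_scale_pi. Qed.
HB.instance Definition _ :=
  GRing.isScalable.Build K V quot_mod *:%R quot_pi quot_pi_is_scalable.

End SubAndQuotientSpaces.

Arguments quot_pi {K V} S x.
Arguments quot_repr {K V} S x.

Section SubOp.
Variables (K : fieldType) (U V W : lmodType K) (B : {bilinear U -> V -> W}).
Variables (R : subspace U) (S : subspace V) (T : subspace W).
Hypothesis BT : forall u v, u \in R -> v \in S -> B u v \in T.

Definition sub_op (u : sub_mod R) (v : sub_mod S) : sub_mod T :=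
  exist _ (B (val u) (val v)) (BT (valP u) (valP v)).

Lemma val_sub_op u v : val (sub_op u v) = B (val u) (val v).
Proof. by []. Qed.

Lemma sub_op_bilinear : bilinear_for *:%R *:%R sub_op.
Proof.
split=> [v|u] a x y; apply: val_inj.
  by rewrite linearP /= linearPl.
by rewrite linearP /= linearPr.
Qed.
HB.instance Definition _ :=
  bilinear_isBilinear.Build K _ _ _ _ _ sub_op sub_op_bilinear.
End SubOp.

Section QuotOp.
Variables (K : fieldType) (U V W : lmodType K) (B : {bilinear U -> V -> W}).
Variables (R : subspace U) (S : subspace V) (T : subspace W).
Hypothesis BRT : forall u v, u \in R -> B u v \in T.
Hypothesis BST : forall u v, v \in S -> B u v \in T.

#[using="All"]
Definition quot_op (u : quot_mod R) (v : quot_mod S) : quot_mod T :=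
  quot_pi T (B (quot_repr R u) (quot_repr S v)).

Lemma quot_op_pi u v : quot_op (quot_pi R u) (quot_pi S v) = quot_pi T (B u v).
Proof.
apply/eqP; rewrite eq_quot_pi.
set u' := quot_repr _ _; set v' := quot_repr _ _.
rewrite -(subrK (B u v') (B u' v')) -addrA -linearBl -linearBr.
by apply: rpredD; [apply: BRT | apply: BST]; apply: quot_repr_pi.
Qed.

Lemma quot_op_bilinear : bilinear_for *:%R *:%R quot_op.
Proof.
split=> [v|u] a x y; rewrite -[x]quot_reprK -[y]quot_reprK.
  by rewrite -[v]quot_reprK -linearP !quot_op_pi -linearP -linearPl.
by rewrite -[u]quot_reprK -linearP !quot_op_pi -linearP -linearPr.
Qed.
HB.instance Definition _ :=
  bilinear_isBilinear.Build K _ _ _ _ _ quot_op quot_op_bilinear.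
End QuotOp.

HB.mixin Record isLeibniz (K : fieldType) V of GRing.Lmodule K V := {
  lbr : {bilinear V -> V -> V};
  lbrA : forall x y z : V,
    lbr x (lbr y z) = lbr (lbr x y) z - lbr (lbr x z) y
}.

#[short(type="leibnizType")]
HB.structure Definition Leibniz (K : fieldType) :=
  {V of isLeibniz K V & GRing.Lmodule K V}.

Notation "{[ x , y ]}" := (lbr x y)
  (at level 0, x, y at level 99, format "{[ x ,  y ]}") : ring_scope.

Record lhom (K : fieldType) (L M : leibnizType K) := LHom {
  lhom_lin :> {linear L -> M};
  lhom_br : forall x y, lhom_lin {[x, y]} = {[lhom_lin x, lhom_lin y]}
}.

Record lsubalg (K : fieldType) (L : leibnizType K) := LSubalg {
  lsubalg_space :> subspace L;
  lsubalg_br : forall x y,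
    x \in lsubalg_space -> y \in lsubalg_space -> {[x, y]} \in lsubalg_space
}.

Record lideal (K : fieldType) (L : leibnizType K) := LIdeal {
  lideal_space :> subspace L;
  lideal_brl : forall x y, x \in lideal_space -> {[x, y]} \in lideal_space;
  lideal_brr : forall x y, y \in lideal_space -> {[x, y]} \in lideal_space
}.

Definition lideal_subalg (K : fieldType) (L : leibnizType K) (I : lideal L) :
  lsubalg L := @LSubalg K L I (fun x y Ix _ => lideal_brl y Ix).

Section SubLeibniz.
Variables (K : fieldType) (L : leibnizType K) (S : lsubalg L).

Definition sub_leibniz := sub_mod S.
HB.instance Definition _ := GRing.Lmodule.on sub_leibniz.

Definition sub_lbr : {bilinear sub_leibniz -> sub_leibniz -> sub_leibniz} :=
  sub_op (@lsubalg_br K L S).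

Lemma sub_lbrA x y z :
  sub_lbr x (sub_lbr y z) = sub_lbr (sub_lbr x y) z - sub_lbr (sub_lbr x z) y.
Proof. by apply: val_inj; rewrite /= lbrA. Qed.

HB.instance Definition _ := isLeibniz.Build K sub_leibniz sub_lbrA.

End SubLeibniz.

Section QuotLeibniz.
Variables (K : fieldType) (L : leibnizType K) (I : lideal L).

Definition quot_leibniz := quot_mod I.
HB.instance Definition _ := GRing.Lmodule.on quot_leibniz.

Definition quot_lbr : {bilinear quot_leibniz -> quot_leibniz -> quot_leibniz} :=
  quot_op (@lideal_brl K L I) (@lideal_brr K L I).

Lemma quot_lbrA x y z :
  quot_lbr x (quot_lbr y z)
  = quot_lbr (quot_lbr x y) z - quot_lbr (quot_lbr x z) y.
Proof.
rewrite -[x]quot_reprK -[y]quot_reprK -[z]quot_reprK /= !quot_op_pi.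
by rewrite lbrA raddfB.
Qed.

HB.instance Definition _ := isLeibniz.Build K quot_leibniz quot_lbrA.

End QuotLeibniz.

(* [lact m n] is ^m n and [ract n m] is n^m *)
Record leibniz_action (K : fieldType) (M N : leibnizType K) := LeibnizAction {
  lact : {bilinear M -> N -> N};
  ract : {bilinear N -> M -> N};
  lact_brl : forall m m' n,
    lact {[m, m']} n = lact m (lact m' n) + ract (lact m n) m';
  lact_brr : forall m n n', lact m {[n, n']} = {[lact m n, n']} - {[lact m n', n]};
  ract_brr : forall n m m',
    ract n {[m, m']} = ract (ract n m) m' - ract (ract n m') m;
  ract_brl : forall n n' m,
    ract {[n, n']} m = {[ract n m, n']} + {[n, ract n' m]};
  lact_lact : forall m m' n, lact m (lact m' n) = - lact m (ract n m');
  br_lact : forall n m n', {[n, lact m n']} = - {[n, ract n' m]}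
}.

Record xmod (K : fieldType) := XMod {
  xtop : leibnizType K;
  xbase : leibnizType K;
  xact : leibniz_action xbase xtop;
  xd : lhom xtop xbase;
  xd_lact : forall q n, xd (lact xact q n) = {[q, xd n]};
  xd_ract : forall q n, xd (ract xact n q) = {[xd n, q]};
  lact_xd : forall n1 n2, lact xact (xd n1) n2 = {[n1, n2]};
  ract_xd : forall n1 n2, ract xact n1 (xd n2) = {[n1, n2]}
}.

Notation xlact X q n := (lact (xact X) q n).
Notation xract X n q := (ract (xact X) n q).

Record xhom (K : fieldType) (X Y : xmod K) := XHom {
  xhom_top : lhom (xtop X) (xtop Y);
  xhom_base : lhom (xbase X) (xbase Y);
  xhom_d : forall n, xhom_base (xd X n) = xd Y (xhom_top n);
  xhom_lact : forall q n,
    xhom_top (xlact X q n) = xlact Y (xhom_base q) (xhom_top n);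
  xhom_ract : forall q n,
    xhom_top (xract X n q) = xract Y (xhom_top n) (xhom_base q)
}.

Definition xinjective (K : fieldType) (X Y : xmod K) (f : xhom X Y) : Prop :=
  injective (xhom_top f) /\ injective (xhom_base f).

Definition xsurjective (K : fieldType) (X Y : xmod K) (f : xhom X Y) : Prop :=
  (forall y, exists x, xhom_top f x = y) /\
  (forall y, exists x, xhom_base f x = y).

Definition xisomorphic (K : fieldType) (X Y : xmod K) : Prop :=
  exists (f : xhom X Y) (g : xhom Y X),
    [/\ cancel (xhom_top f) (xhom_top g), cancel (xhom_top g) (xhom_top f),
        cancel (xhom_base f) (xhom_base g) &
        cancel (xhom_base g) (xhom_base f)].

Definition finite_dimensional_space (K : fieldType) (V : lmodType K) : Prop :=
  exists n : nat, inhabited (Vector.axiom n V).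

Definition xfinite_dimensional (K : fieldType) (X : xmod K) : Prop :=
  finite_dimensional_space (xtop X) /\ finite_dimensional_space (xbase X).

Record xsub (K : fieldType) (X : xmod K) := XSub {
  xsub_top : subspace (xtop X);
  xsub_base : subspace (xbase X);
  xsub_br : forall p q,
    p \in xsub_base -> q \in xsub_base -> {[p, q]} \in xsub_base;
  xsub_d : forall n, n \in xsub_top -> xd X n \in xsub_base;
  xsub_lact : forall q n,
    q \in xsub_base -> n \in xsub_top -> xlact X q n \in xsub_top;
  xsub_ract : forall n q,
    n \in xsub_top -> q \in xsub_base -> xract X n q \in xsub_top
}.

Definition xsub_le (K : fieldType) (X : xmod K) (S T : xsub X) : Prop :=
  {subset xsub_top S <= xsub_top T} /\ {subset xsub_base S <= xsub_base T}.

Definition xsub_eq (K : fieldType) (X : xmod K) (S T : xsub X) : Prop :=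
  xsub_top S =i xsub_top T /\ xsub_base S =i xsub_base T.

Definition xsub_is0 (K : fieldType) (X : xmod K) (S : xsub X) : Prop :=
  (forall n, n \in xsub_top S -> n = 0) /\
  (forall q, q \in xsub_base S -> q = 0).

Definition xdirect_sum (K : fieldType) (X : xmod K) (S A B : xsub X) : Prop :=
  [/\ forall n, n \in xsub_top S <->
        exists a b, [/\ a \in xsub_top A, b \in xsub_top B & n = a + b],
      forall n, n \in xsub_top A -> n \in xsub_top B -> n = 0,
      forall q, q \in xsub_base S <->
        exists a b, [/\ a \in xsub_base A, b \in xsub_base B & q = a + b] &
      forall q, q \in xsub_base A -> q \in xsub_base B -> q = 0].

Definition xfull (K : fieldType) (X : xmod K) : xsub X :=
  @XSub K X (fullspace _) (fullspace _)
    (fun _ _ _ _ => isT) (fun _ _ => isT)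
    (fun _ _ _ _ => isT) (fun _ _ _ _ => isT).

Section XCap.
Variables (K : fieldType) (X : xmod K) (S T : xsub X).

Let top := capspace (xsub_top S) (xsub_top T).
Let base := capspace (xsub_base S) (xsub_base T).

Lemma xcap_br p q : p \in base -> q \in base -> {[p, q]} \in base.
Proof.
by rewrite !in_capspace => /andP[? ?] /andP[? ?]; rewrite !xsub_br.
Qed.
Lemma xcap_d n : n \in top -> xd X n \in base.
Proof. by rewrite !in_capspace => /andP[? ?]; rewrite !xsub_d. Qed.
Lemma xcap_lact q n : q \in base -> n \in top -> xlact X q n \in top.
Proof.
by rewrite !in_capspace => /andP[? ?] /andP[? ?]; rewrite !xsub_lact.
Qed.
Lemma xcap_ract n q : n \in top -> q \in base -> xract X n q \in top.
Proof.
by rewrite !in_capspace => /andP[? ?] /andP[? ?]; rewrite !xsub_ract.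
Qed.

Definition xcap : xsub X := XSub xcap_br xcap_d xcap_lact xcap_ract.
End XCap.

Section XKer.
Variables (K : fieldType) (X Y : xmod K) (f : xhom X Y).

Let top := kerspace (xhom_top f).
Let base := kerspace (xhom_base f).

Lemma xker_br p q : p \in base -> q \in base -> {[p, q]} \in base.
Proof.
by rewrite !in_kerspace lhom_br => /eqP-> _; rewrite linear0l.
Qed.
Lemma xker_d n : n \in top -> xd X n \in base.
Proof. by rewrite !in_kerspace xhom_d => /eqP->; rewrite linear0. Qed.
Lemma xker_lact q n : q \in base -> n \in top -> xlact X q n \in top.
Proof. by rewrite !in_kerspace xhom_lact => /eqP-> _; rewrite linear0l. Qed.
Lemma xker_ract n q : n \in top -> q \in base -> xract X n q \in top.
Proof. by rewrite !in_kerspace xhom_ract => /eqP-> _; rewrite linear0l. Qed.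

Definition xker : xsub X := XSub xker_br xker_d xker_lact xker_ract.
End XKer.

Section XImage.
Variables (K : fieldType) (X Y : xmod K) (f : xhom X Y) (S : xsub X).

Let top := imspace (xhom_top f) (xsub_top S).
Let base := imspace (xhom_base f) (xsub_base S).

Lemma ximage_br p q : p \in base -> q \in base -> {[p, q]} \in base.
Proof.
move=> /in_imspace[x Sx <-] /in_imspace[y Sy <-]; apply/in_imspace.
by exists {[x, y]}; rewrite ?lhom_br // xsub_br.
Qed.
Lemma ximage_d n : n \in top -> xd Y n \in base.
Proof.
move=> /in_imspace[x Sx <-]; apply/in_imspace.
by exists (xd X x); rewrite ?xhom_d // xsub_d.
Qed.
Lemma ximage_lact q n : q \in base -> n \in top -> xlact Y q n \in top.
Proof.
move=> /in_imspace[x Sx <-] /in_imspace[y Sy <-]; apply/in_imspace.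
by exists (xlact X x y); rewrite ?xhom_lact // xsub_lact.
Qed.
Lemma ximage_ract n q : n \in top -> q \in base -> xract Y n q \in top.
Proof.
move=> /in_imspace[x Sx <-] /in_imspace[y Sy <-]; apply/in_imspace.
by exists (xract X x y); rewrite ?xhom_ract // xsub_ract.
Qed.

Definition ximage : xsub Y := XSub ximage_br ximage_d ximage_lact ximage_ract.
End XImage.

Section XSubXMod.
Variables (K : fieldType) (X : xmod K) (S : xsub X).

Lemma xsub_top_br m n :
  m \in xsub_top S -> n \in xsub_top S -> {[m, n]} \in xsub_top S.
Proof. by move=> Sm Sn; rewrite -lact_xd xsub_lact ?xsub_d. Qed.

Definition xsub_top_leibniz : leibnizType K :=
  sub_leibniz (LSubalg xsub_top_br).
Definition xsub_base_leibniz : leibnizType K :=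
  sub_leibniz (LSubalg (@xsub_br K X S)).

Definition xsub_act_l :
    {bilinear xsub_base_leibniz -> xsub_top_leibniz -> xsub_top_leibniz} :=
  sub_op (@xsub_lact K X S).
Definition xsub_act_r :
    {bilinear xsub_top_leibniz -> xsub_base_leibniz -> xsub_top_leibniz} :=
  sub_op (@xsub_ract K X S).

Definition xsub_action : leibniz_action xsub_base_leibniz xsub_top_leibniz.
Proof.
exists xsub_act_l xsub_act_r => *; apply: val_inj => /=.
- exact: lact_brl.
- exact: lact_brr.
- exact: ract_brr.
- exact: ract_brl.
- exact: lact_lact.
- exact: br_lact.
Defined.

Definition xsub_d_fun (n : xsub_top_leibniz) : xsub_base_leibniz :=
  exist _ (xd X (val n)) (xsub_d (valP n)).

Lemma xsub_d_is_linear : linear xsub_d_fun.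
Proof. by move=> a u v; apply: val_inj; rewrite /= linearP. Qed.
HB.instance Definition _ := GRing.isLinear.Build K
  xsub_top_leibniz xsub_base_leibniz *:%R xsub_d_fun xsub_d_is_linear.

Definition xsub_d_hom : lhom xsub_top_leibniz xsub_base_leibniz.
Proof.
by exists xsub_d_fun => x y; apply: val_inj; rewrite /= lhom_br.
Defined.

Definition xmod_of_sub : xmod K.
Proof.
exists xsub_top_leibniz xsub_base_leibniz xsub_action xsub_d_hom => *;
  apply: val_inj => /=.
- exact: xd_lact.
- exact: xd_ract.
- exact: lact_xd.
- exact: ract_xd.
Defined.

Definition xsub_top_inc : lhom xsub_top_leibniz (xtop X) :=
  @LHom K xsub_top_leibniz (xtop X)
    (val : {linear sub_mod (xsub_top S) -> xtop X}) (fun _ _ => erefl).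
Definition xsub_base_inc : lhom xsub_base_leibniz (xbase X) :=
  @LHom K xsub_base_leibniz (xbase X)
    (val : {linear sub_mod (xsub_base S) -> xbase X}) (fun _ _ => erefl).
Definition xsub_inc : xhom xmod_of_sub X :=
  @XHom K xmod_of_sub X xsub_top_inc xsub_base_inc
    (fun _ => erefl) (fun _ _ => erefl) (fun _ _ => erefl).

End XSubXMod.

Definition is_crossed_ideal (K : fieldType) (X : xmod K) (S : xsub X) : Prop :=
  exists (Y : xmod K) (f : xhom X Y), xsub_eq S (xker f).

Record xideal (K : fieldType) (X : xmod K) := XIdeal {
  xideal_sub :> xsub X;
  xideal_ker : is_crossed_ideal xideal_sub
}.

(* The closure properties that make the componentwise quotient of X by
   (top, base) a crossed module; they are shown below to characterise kernels. *)
Record ideal_pair (K : fieldType) (X : xmod K)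
    (top : subspace (xtop X)) (base : subspace (xbase X)) : Prop := {
  ideal_brl : forall p q, p \in base -> {[p, q]} \in base;
  ideal_brr : forall p q, q \in base -> {[p, q]} \in base;
  ideal_lactl : forall q n, q \in base -> xlact X q n \in top;
  ideal_lactr : forall q n, n \in top -> xlact X q n \in top;
  ideal_ractl : forall n q, n \in top -> xract X n q \in top;
  ideal_ractr : forall n q, q \in base -> xract X n q \in top;
  ideal_d : forall n, n \in top -> xd X n \in base
}.

Lemma crossed_ideal_pair (K : fieldType) (X : xmod K) (S : xsub X) :
  is_crossed_ideal S -> ideal_pair (xsub_top S) (xsub_base S).
Proof.
move=> [Y [f [eq_top eq_base]]].
have topE n : (n \in xsub_top S) = (xhom_top f n == 0) by rewrite eq_top.
have baseE q : (q \in xsub_base S) = (xhom_base f q == 0) by rewrite eq_base.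
split=> [x y|x y|x y|x y|x y|x y|x]; rewrite ?topE ?baseE => /eqP fx0.
- by rewrite lhom_br fx0 linear0l.
- by rewrite lhom_br fx0 linear0r.
- by rewrite xhom_lact fx0 linear0l.
- by rewrite xhom_lact fx0 linear0r.
- by rewrite xhom_ract fx0 linear0l.
- by rewrite xhom_ract fx0 linear0r.
- by rewrite xhom_d fx0 linear0.
Qed.

Section QuotientByPair.
Variables (K : fieldType) (X : xmod K).
Variables (top : subspace (xtop X)) (base : subspace (xbase X)).
Hypothesis idealP : ideal_pair top base.

Lemma ideal_top_brl m n : m \in top -> {[m, n]} \in top.
Proof. by move=> Sm; rewrite -ract_xd (ideal_ractl idealP). Qed.
Lemma ideal_top_brr m n : n \in top -> {[m, n]} \in top.
Proof. by move=> Sn; rewrite -lact_xd (ideal_lactr idealP). Qed.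

Definition pair_xsub : xsub X :=
  XSub (fun p q bp _ => ideal_brl idealP q bp) (ideal_d idealP)
    (fun q n _ tn => ideal_lactr idealP q tn)
    (fun n q tn _ => ideal_ractl idealP q tn).

Definition pquot_top : leibnizType K :=
  quot_leibniz (LIdeal ideal_top_brl ideal_top_brr).
Definition pquot_base : leibnizType K :=
  quot_leibniz (LIdeal (ideal_brl idealP) (ideal_brr idealP)).

Definition pquot_act_l : {bilinear pquot_base -> pquot_top -> pquot_top} :=
  quot_op (ideal_lactl idealP) (ideal_lactr idealP).
Definition pquot_act_r : {bilinear pquot_top -> pquot_base -> pquot_top} :=
  quot_op (ideal_ractl idealP) (ideal_ractr idealP).

Definition pproj_top : lhom (xtop X) pquot_top :=
  @LHom K (xtop X) pquot_top (quot_pi top)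
    (fun x y => esym (quot_op_pi ideal_top_brl ideal_top_brr x y)).
Definition pproj_base : lhom (xbase X) pquot_base :=
  @LHom K (xbase X) pquot_base (quot_pi base)
    (fun x y => esym (quot_op_pi (ideal_brl idealP) (ideal_brr idealP) x y)).

Lemma pproj_topP (x : pquot_top) : exists n, x = pproj_top n.
Proof. by exists (quot_repr top x); rewrite /= quot_reprK. Qed.
Lemma pproj_baseP (x : pquot_base) : exists q, x = pproj_base q.
Proof. by exists (quot_repr base x); rewrite /= quot_reprK. Qed.

Lemma pquot_act_l_pi q n :
  pquot_act_l (pproj_base q) (pproj_top n) = pproj_top (xlact X q n).
Proof. exact: quot_op_pi. Qed.
Lemma pquot_act_r_pi n q :
  pquot_act_r (pproj_top n) (pproj_base q) = pproj_top (xract X n q).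
Proof. exact: quot_op_pi. Qed.

Definition pquot_action : leibniz_action pquot_base pquot_top.
Proof.
exists pquot_act_l pquot_act_r.
- move=> x y z; have [[[p ->] [q ->]] [n ->]] :=
    (pproj_baseP x, pproj_baseP y, pproj_topP z).
  rewrite -lhom_br !(pquot_act_l_pi, pquot_act_r_pi) lact_brl.
  by rewrite linearD.
- move=> x y z; have [[[p ->] [m ->]] [n ->]] :=
    (pproj_baseP x, pproj_topP y, pproj_topP z).
  by rewrite -lhom_br !pquot_act_l_pi lact_brr -!lhom_br linearB.
- move=> x y z; have [[[n ->] [p ->]] [q ->]] :=
    (pproj_topP x, pproj_baseP y, pproj_baseP z).
  by rewrite -lhom_br !pquot_act_r_pi ract_brr linearB.
- move=> x y z; have [[[m ->] [n ->]] [p ->]] :=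
    (pproj_topP x, pproj_topP y, pproj_baseP z).
  by rewrite -lhom_br !pquot_act_r_pi ract_brl -!lhom_br linearD.
- move=> x y z; have [[[p ->] [q ->]] [n ->]] :=
    (pproj_baseP x, pproj_baseP y, pproj_topP z).
  by rewrite !(pquot_act_l_pi, pquot_act_r_pi) lact_lact linearN.
- move=> x y z; have [[[m ->] [q ->]] [n ->]] :=
    (pproj_topP x, pproj_baseP y, pproj_topP z).
  by rewrite !(pquot_act_l_pi, pquot_act_r_pi) -!lhom_br br_lact linearN.
Defined.

Definition pquot_d_fun (n : pquot_top) : pquot_base :=
  pproj_base (xd X (quot_repr top n)).

Lemma pquot_d_pi n : pquot_d_fun (pproj_top n) = pproj_base (xd X n).
Proof.
apply/eqP; rewrite eq_quot_pi -linearB (ideal_d idealP) //.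
exact: quot_repr_pi.
Qed.

Lemma pquot_d_is_linear : linear pquot_d_fun.
Proof.
move=> a x y; have [[m ->] [n ->]] := (pproj_topP x, pproj_topP y).
by rewrite -linearP !pquot_d_pi !linearP.
Qed.
HB.instance Definition _ := GRing.isLinear.Build K
  pquot_top pquot_base *:%R pquot_d_fun pquot_d_is_linear.

Definition pquot_d : lhom pquot_top pquot_base.
Proof.
exists pquot_d_fun => x y; have [[m ->] [n ->]] := (pproj_topP x, pproj_topP y).
by rewrite -lhom_br /= !pquot_d_pi lhom_br lhom_br.
Defined.

Definition pquot : xmod K.
Proof.
exists pquot_top pquot_base pquot_action pquot_d.
- move=> x y; have [[q ->] [n ->]] := (pproj_baseP x, pproj_topP y).
  by rewrite /= pquot_act_l_pi !pquot_d_pi xd_lact lhom_br.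
- move=> x y; have [[q ->] [n ->]] := (pproj_baseP x, pproj_topP y).
  by rewrite /= pquot_act_r_pi !pquot_d_pi xd_ract lhom_br.
- move=> x y; have [[m ->] [n ->]] := (pproj_topP x, pproj_topP y).
  by rewrite /= pquot_d_pi pquot_act_l_pi lact_xd lhom_br.
- move=> x y; have [[m ->] [n ->]] := (pproj_topP x, pproj_topP y).
  by rewrite /= pquot_d_pi pquot_act_r_pi ract_xd lhom_br.
Defined.

Definition pproj : xhom X pquot :=
  @XHom K X pquot pproj_top pproj_base (fun n => esym (pquot_d_pi n))
    (fun q n => esym (pquot_act_l_pi q n)) (fun q n => esym (pquot_act_r_pi n q)).

Lemma pair_xsub_ideal : is_crossed_ideal pair_xsub.
Proof.
exists pquot, pproj; split=> x; rewrite in_kerspace /=.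
  by rewrite -(linear0 (quot_pi top)) eq_quot_pi subr0.
by rewrite -(linear0 (quot_pi base)) eq_quot_pi subr0.
Qed.

Definition pair_xideal : xideal X := XIdeal pair_xsub_ideal.

End QuotientByPair.

Definition xquot (K : fieldType) (X : xmod K) (I : xideal X) : xmod K :=
  pquot (crossed_ideal_pair (xideal_ker I)).

Definition xproj (K : fieldType) (X : xmod K) (I : xideal X) :
  xhom X (xquot I) := pproj (crossed_ideal_pair (xideal_ker I)).

Lemma xfull_is_ideal (K : fieldType) (X : xmod K) : is_crossed_ideal (xfull X).
Proof.
have full_pair : ideal_pair (fullspace (xtop X)) (fullspace (xbase X)) by [].
have [Y [f [eq_top eq_base]]] := pair_xsub_ideal full_pair.
by exists Y, f; split.
Qed.

Definition xfull_ideal (K : fieldType) (X : xmod K) : xideal X :=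
  XIdeal (xfull_is_ideal X).

(* S / I, as a crossed submodule of X / I (used for I contained in S) *)
Definition xquot_sub (K : fieldType) (X : xmod K) (I : xideal X) (S : xsub X) :
  xsub (xquot I) := ximage (xproj I) S.

Section XQuotLift.
Variables (K : fieldType) (X Y : xmod K) (I : xideal X) (f : xhom X Y).
Hypothesis leIf : xsub_le I (xker f).

Definition xquot_lift_top_fun (x : xtop (xquot I)) : xtop Y :=
  xhom_top f (quot_repr (xsub_top I) x).
Definition xquot_lift_base_fun (x : xbase (xquot I)) : xbase Y :=
  xhom_base f (quot_repr (xsub_base I) x).

Lemma xquot_topP (x : xtop (xquot I)) : exists n, x = xhom_top (xproj I) n.
Proof. exact: pproj_topP. Qed.
Lemma xquot_baseP (x : xbase (xquot I)) : exists n, x = xhom_base (xproj I) n.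
Proof. exact: pproj_baseP. Qed.

Lemma xquot_lift_top_proj n :
  xquot_lift_top_fun (xhom_top (xproj I) n) = xhom_top f n.
Proof.
apply/eqP; rewrite -subr_eq0 -linearB; apply: leIf.1; exact: quot_repr_pi.
Qed.
Lemma xquot_lift_base_proj q :
  xquot_lift_base_fun (xhom_base (xproj I) q) = xhom_base f q.
Proof.
apply/eqP; rewrite -subr_eq0 -linearB; apply: leIf.2; exact: quot_repr_pi.
Qed.

Lemma xquot_lift_top_is_linear : linear xquot_lift_top_fun.
Proof.
move=> a x y; have [[m ->] [n ->]] := (xquot_topP x, xquot_topP y).
by rewrite -linearP !xquot_lift_top_proj linearP.
Qed.
HB.instance Definition _ := GRing.isLinear.Build K
  (xtop (xquot I)) (xtop Y) *:%R xquot_lift_top_fun xquot_lift_top_is_linear.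

Lemma xquot_lift_base_is_linear : linear xquot_lift_base_fun.
Proof.
move=> a x y; have [[m ->] [n ->]] := (xquot_baseP x, xquot_baseP y).
by rewrite -linearP !xquot_lift_base_proj linearP.
Qed.
HB.instance Definition _ := GRing.isLinear.Build K
  (xbase (xquot I)) (xbase Y) *:%R
  xquot_lift_base_fun xquot_lift_base_is_linear.

Lemma xquot_lift_top_br x y :
  xquot_lift_top_fun {[x, y]}
  = {[xquot_lift_top_fun x, xquot_lift_top_fun y]}.
Proof.
have [[m ->] [n ->]] := (xquot_topP x, xquot_topP y).
by rewrite -lhom_br !xquot_lift_top_proj lhom_br.
Qed.
Definition xquot_lift_top : lhom (xtop (xquot I)) (xtop Y) :=
  LHom xquot_lift_top_br.

Lemma xquot_lift_base_br x y :
  xquot_lift_base_fun {[x, y]}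
  = {[xquot_lift_base_fun x, xquot_lift_base_fun y]}.
Proof.
have [[m ->] [n ->]] := (xquot_baseP x, xquot_baseP y).
by rewrite -lhom_br !xquot_lift_base_proj lhom_br.
Qed.
Definition xquot_lift_base : lhom (xbase (xquot I)) (xbase Y) :=
  LHom xquot_lift_base_br.

Lemma xquot_lift_topE n :
  xquot_lift_top (xhom_top (xproj I) n) = xhom_top f n.
Proof. exact: xquot_lift_top_proj. Qed.
Lemma xquot_lift_baseE q :
  xquot_lift_base (xhom_base (xproj I) q) = xhom_base f q.
Proof. exact: xquot_lift_base_proj. Qed.

Lemma xquot_lift_d x :
  xquot_lift_base (xd (xquot I) x) = xd Y (xquot_lift_top x).
Proof.
have [n ->] := xquot_topP x.
by rewrite -xhom_d xquot_lift_baseE xquot_lift_topE xhom_d.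
Qed.
Lemma xquot_lift_lact y x :
  xquot_lift_top (xlact (xquot I) y x)
  = xlact Y (xquot_lift_base y) (xquot_lift_top x).
Proof.
have [[q ->] [n ->]] := (xquot_baseP y, xquot_topP x).
by rewrite -xhom_lact xquot_lift_baseE !xquot_lift_topE xhom_lact.
Qed.
Lemma xquot_lift_ract y x :
  xquot_lift_top (xract (xquot I) x y)
  = xract Y (xquot_lift_top x) (xquot_lift_base y).
Proof.
have [[q ->] [n ->]] := (xquot_baseP y, xquot_topP x).
by rewrite -xhom_ract xquot_lift_baseE !xquot_lift_topE xhom_ract.
Qed.

Definition xquot_lift : xhom (xquot I) Y :=
  XHom xquot_lift_d xquot_lift_lact xquot_lift_ract.

End XQuotLift.

(* The commutator of two crossed ideals. For crossed ideals the linear spans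
   below are already closed under all brackets and actions, so that "generated"
   means the same whether read as subspace, as subalgebra or as ideal. *)
Section XCommutator.
Variables (K : fieldType) (X : xmod K) (S T : xideal X).

(* D_h(t), for h the base of A and t the top of B *)
Definition act_set (A B : xsub X) (n : xtop X) : Prop :=
  exists h t, [/\ h \in xsub_base A, t \in xsub_top B &
                  n = xlact X h t \/ n = xract X t h].

Definition br_set (A B : xsub X) (q : xbase X) : Prop :=
  exists x y, [/\ x \in xsub_base A, y \in xsub_base B &
                  q = {[x, y]} \/ q = {[y, x]}].

Definition xcomm_top : subspace (xtop X) :=
  spanspace (fun n => act_set S T n \/ act_set T S n).
Definition xcomm_base : subspace (xbase X) := spanspace (br_set S T).

Lemma xcomm_pair : ideal_pair xcomm_top xcomm_base.
Proof.
have idS := crossed_ideal_pair (xideal_ker S).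
have idT := crossed_ideal_pair (xideal_ker T).
have inbr x y : x \in xsub_base S -> y \in xsub_base T ->
    {[x, y]} \in xcomm_base /\ {[y, x]} \in xcomm_base.
  move=> Sx Ty; split; apply: mem_spanspace.
    by exists x, y; split=> //; left.
  by exists x, y; split=> //; right.
have inact (A B : xideal X) h t : h \in xsub_base A -> t \in xsub_top B ->
    (forall n, act_set A B n -> n \in xcomm_top) ->
    xlact X h t \in xcomm_top /\ xract X t h \in xcomm_top.
  move=> Ah Bt AB; split; apply: AB.
    by exists h, t; split=> //; left.
  by exists h, t; split=> //; right.
have ST n : act_set S T n -> n \in xcomm_top.
  by move=> STn; apply: mem_spanspace; left.
have TS n : act_set T S n -> n \in xcomm_top.
  by move=> TSn; apply: mem_spanspace; right.
have actD (A B : xideal X) (idA : ideal_pair (xsub_top A) (xsub_base A))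
    (idB : ideal_pair (xsub_top B) (xsub_base B)) q n :
    (forall n, act_set A B n -> n \in xcomm_top) -> act_set A B n ->
    xlact X q n \in xcomm_top /\ xract X n q \in xcomm_top.
  move=> AB [h [t [Ah Bt nE]]].
  have ql t' : t' \in xsub_top B -> xlact X h t' \in xcomm_top.
    by move=> Bt'; have [] := inact A B h t' Ah Bt' AB.
  have qr t' : t' \in xsub_top B -> xract X t' h \in xcomm_top.
    by move=> Bt'; have [] := inact A B h t' Ah Bt' AB.
  have bl h' : h' \in xsub_base A -> xlact X h' t \in xcomm_top.
    by move=> Ah'; have [] := inact A B h' t Ah' Bt AB.
  have br h' : h' \in xsub_base A -> xract X t h' \in xcomm_top.
    by move=> Ah'; have [] := inact A B h' t Ah' Bt AB.
  have lact_lactE : xlact X q (xlact X h t) =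
      xlact X {[q, h]} t - xract X (xlact X q t) h.
    by rewrite lact_brl addrK.
  have ract_lactE : xract X (xlact X h t) q =
      xlact X {[h, q]} t - xlact X h (xlact X q t).
    by rewrite lact_brl addrC addKr.
  have ract_ractE : xract X (xract X t h) q =
      xract X t {[h, q]} + xract X (xract X t q) h.
    by rewrite ract_brr subrK.
  have Bqt : xlact X q t \in xsub_top B by apply: (ideal_lactr idB).
  have Btq : xract X t q \in xsub_top B by apply: (ideal_ractl idB).
  have Aqh : {[q, h]} \in xsub_base A by apply: (ideal_brr idA).
  have Ahq : {[h, q]} \in xsub_base A by apply: (ideal_brl idA).
  case: nE => ->; rewrite ?ract_lactE ?ract_ractE; split.
  - by rewrite lact_lactE rpredB ?bl ?qr.
  - by rewrite rpredB ?bl ?ql.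
  - by rewrite -[xlact X q _]opprK -lact_lact rpredN lact_lactE rpredB ?bl ?qr.
  - by rewrite rpredD ?br ?qr.
have lin_lbr p : linear (lbr p : xbase X -> xbase X) by move=> *; apply: linearPr.
have lin_lbl p : linear ((fun q => {[q, p]}) : xbase X -> xbase X).
  by move=> *; apply: linearPl.
split.
- move=> p q; apply: (span_preimage (lin_lbl q)) => _ [x [y [Sx Ty [->|->]]]].
  + have -> : {[{[x, y]}, q]} = {[x, {[y, q]}]} + {[{[x, q]}, y]}.
      by rewrite lbrA subrK.
    apply: rpredD.
    * exact: (inbr _ _ Sx (ideal_brl idT _ Ty)).1.
    * exact: (inbr _ _ (ideal_brl idS _ Sx) Ty).1.
  + have -> : {[{[y, x]}, q]} = {[y, {[x, q]}]} + {[{[y, q]}, x]}.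
      by rewrite lbrA subrK.
    apply: rpredD.
    * exact: (inbr _ _ (ideal_brl idS _ Sx) Ty).2.
    * exact: (inbr _ _ Sx (ideal_brl idT _ Ty)).2.
- move=> p q; apply: (span_preimage (lin_lbr p)) => _ [x [y [Sx Ty [->|->]]]].
  + rewrite lbrA; apply: rpredB.
    * exact: (inbr _ _ (ideal_brr idS _ Sx) Ty).1.
    * exact: (inbr _ _ Sx (ideal_brr idT _ Ty)).2.
  + rewrite lbrA; apply: rpredB.
    * exact: (inbr _ _ Sx (ideal_brr idT _ Ty)).2.
    * exact: (inbr _ _ (ideal_brr idS _ Sx) Ty).1.
- move=> q n.
  have lin_n : linear ((fun q => xlact X q n) : xbase X -> xtop X).
    by move=> *; apply: linearPl.
  apply: (span_preimage lin_n) => _ [x [y [Sx Ty [->|->]]]]; rewrite lact_brl.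
  + apply: rpredD.
    * exact: (inact _ _ _ _ Sx (ideal_lactl idT n Ty) ST).1.
    * exact: (inact _ _ _ _ Ty (ideal_lactl idS n Sx) TS).2.
  + apply: rpredD.
    * exact: (inact _ _ _ _ Ty (ideal_lactl idS n Sx) TS).1.
    * exact: (inact _ _ _ _ Sx (ideal_lactl idT n Ty) ST).2.
- move=> q n.
  have lin_q : linear ((fun n => xlact X q n) : xtop X -> xtop X).
    by move=> *; apply: linearPr.
  apply: (span_preimage lin_q) => m [] Dm.
  + exact: (actD S T idS idT q m ST Dm).1.
  + exact: (actD T S idT idS q m TS Dm).1.
- move=> n q.
  have lin_q : linear ((fun n => xract X n q) : xtop X -> xtop X).
    by move=> *; apply: linearPl.
  apply: (span_preimage lin_q) => m [] Dm.
  + exact: (actD S T idS idT q m ST Dm).2.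
  + exact: (actD T S idT idS q m TS Dm).2.
- move=> n q.
  have lin_n : linear ((fun q => xract X n q) : xbase X -> xtop X).
    by move=> *; apply: linearPr.
  apply: (span_preimage lin_n) => _ [x [y [Sx Ty [->|->]]]]; rewrite ract_brr.
  + apply: rpredB.
    * exact: (inact _ _ _ _ Ty (ideal_ractr idS n Sx) TS).2.
    * exact: (inact _ _ _ _ Sx (ideal_ractr idT n Ty) ST).2.
  + apply: rpredB.
    * exact: (inact _ _ _ _ Sx (ideal_ractr idT n Ty) ST).2.
    * exact: (inact _ _ _ _ Ty (ideal_ractr idS n Sx) TS).2.
- have lin_d : linear (xd X) by apply: linearP.
  move=> n; apply: (span_preimage lin_d) => _ [] [h [t [Ah Bt [->|->]]]];
    rewrite ?xd_lact ?xd_ract.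
  + exact: (inbr _ _ Ah (ideal_d idT Bt)).1.
  + exact: (inbr _ _ Ah (ideal_d idT Bt)).2.
  + exact: (inbr _ _ (ideal_d idS Bt) Ah).2.
  + exact: (inbr _ _ (ideal_d idS Bt) Ah).1.
Qed.

Definition xcomm : xideal X := pair_xideal xcomm_pair.

End XCommutator.

Definition is_free_leibniz (K : fieldType) (X : Type) (F : leibnizType K)
    (i : X -> F) : Prop :=
  forall (L : leibnizType K) (f : X -> L),
    exists2 g : lhom F L, (forall x, g (i x) = f x) &
      forall h : lhom F L, (forall x, h (i x) = f x) -> h =1 g.

Definition is_leibniz_coproduct (K : fieldType) (A B C : leibnizType K)
    (i1 : lhom A C) (i2 : lhom B C) : Prop :=
  forall (L : leibnizType K) (f : lhom A L) (g : lhom B L),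
    exists2 h : lhom C L, (forall a, h (i1 a) = f a) /\ (forall b, h (i2 b) = g b) &
      forall k : lhom C L,
        (forall a, k (i1 a) = f a) -> (forall b, k (i2 b) = g b) -> k =1 h.

Section InclusionXMod.
Variables (K : fieldType) (L : leibnizType K) (I : lideal L).

Definition incl_top : leibnizType K := sub_leibniz (lideal_subalg I).

Definition incl_lact (q : L) (n : incl_top) : incl_top :=
  exist _ {[q, val n]} (lideal_brr q (valP n)).
Definition incl_ract (n : incl_top) (q : L) : incl_top :=
  exist _ {[val n, q]} (lideal_brl q (valP n)).

Lemma incl_lact_bilinear : bilinear_for *:%R *:%R incl_lact.
Proof.
split=> [n|q] a x y; apply: val_inj; first by rewrite /= linearPl.
by rewrite [RHS]linearP /= linearPr.
Qed.
HB.instance Definition _ :=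
  bilinear_isBilinear.Build K _ _ _ _ _ incl_lact incl_lact_bilinear.

Lemma incl_ract_bilinear : bilinear_for *:%R *:%R incl_ract.
Proof.
split=> [q|n] a x y; apply: val_inj; last by rewrite /= linearPr.
by rewrite [RHS]linearP /= linearPl.
Qed.
HB.instance Definition _ :=
  bilinear_isBilinear.Build K _ _ _ _ _ incl_ract incl_ract_bilinear.

Lemma lbrA_sub (x y z : L) :
  {[{[x, y]}, z]} = {[x, {[y, z]}]} + {[{[x, z]}, y]}.
Proof. by rewrite lbrA subrK. Qed.

Lemma lbrC_right (x y z : L) : {[x, {[y, z]}]} = - {[x, {[z, y]}]}.
Proof. by rewrite !lbrA opprB. Qed.

Definition incl_action : leibniz_action L incl_top.
Proof.
exists incl_lact incl_ract => *; apply: val_inj => /=.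
- exact: lbrA_sub.
- exact: lbrA.
- exact: lbrA.
- by rewrite lbrA_sub addrC.
- exact: lbrC_right.
- exact: lbrC_right.
Defined.

Definition incl_hom : lhom incl_top L :=
  @LHom K incl_top L (val : {linear sub_mod I -> L}) (fun _ _ => erefl).

Definition incl_xmod : xmod K :=
  @XMod K incl_top L incl_action incl_hom (fun _ _ => erefl)
    (fun _ _ => erefl)
    (fun m n => val_inj (erefl : val (incl_lact (val m) n) = val {[m, n]}))
    (fun m n => val_inj (erefl : val (incl_ract m (val n)) = val {[m, n]})).

End InclusionXMod.

Section LKer.
Variables (K : fieldType) (L M : leibnizType K) (f : lhom L M).

Lemma lker_brl x y : x \in kerspace f -> {[x, y]} \in kerspace f.
Proof. by rewrite !in_kerspace lhom_br => /eqP->; rewrite linear0l. Qed.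
Lemma lker_brr x y : y \in kerspace f -> {[x, y]} \in kerspace f.
Proof. by rewrite !in_kerspace lhom_br => /eqP->; rewrite linear0r. Qed.
Definition lker : lideal L := LIdeal lker_brl lker_brr.
End LKer.

(* Free objects are taken up to isomorphism: F(X) and F(X) * F(X) are given by
   their universal properties, and Y is isomorphic to the inclusion of the
   kernel of p2. *)
Definition is_free_xmod (K : fieldType) (Y : xmod K) : Prop :=
  exists (X : Type) (F C : leibnizType K) (i : X -> F) (i1 i2 : lhom F C)
      (p2 : lhom C F),
    [/\ is_free_leibniz i, is_leibniz_coproduct i1 i2,
        forall x, p2 (i1 x) = 0, forall x, p2 (i2 x) = x &
        xisomorphic Y (incl_xmod (lker p2))].

Record extension (K : fieldType) (N : xmod K) := Extension {
  ext_ker : xmod K;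
  ext_tot : xmod K;
  ext_inc : xhom ext_ker ext_tot;
  ext_proj : xhom ext_tot N;
  ext_inc_inj : xinjective ext_inc;
  ext_proj_surj : xsurjective ext_proj;
  ext_exact : xsub_eq (ximage ext_inc (xfull ext_ker)) (xker ext_proj)
}.

Lemma ext_ideal_is_ideal (K : fieldType) (N : xmod K) (E : extension N) :
  is_crossed_ideal (ximage (ext_inc E) (xfull (ext_ker E))).
Proof. by exists N, (ext_proj E); apply: ext_exact. Qed.

Definition ext_ideal (K : fieldType) (N : xmod K) (E : extension N) :
  xideal (ext_tot E) := XIdeal (ext_ideal_is_ideal E).

Section SchurMultiplier.
Variables (K : fieldType) (N : xmod K) (P : extension N).
Local Notation M := (ext_tot P).
Local Notation U := (ext_ideal P).

Definition pres_comm : xideal M := xcomm U (xfull_ideal M).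

(* With P the presentation 0 -> U -> M -> N -> 0, this is (U /\ [M,M]) / [U,M]
   regarded as a crossed submodule of M / [U,M]; up to isomorphism it does not
   depend on the projective presentation P of N. *)
Definition schur_multiplier : xsub (xquot pres_comm) :=
  xquot_sub pres_comm (xcap U (xcomm (xfull_ideal M) (xfull_ideal M))).

End SchurMultiplier.

Definition is_central_extension (K : fieldType) (N : xmod K)
    (E : extension N) : Prop :=
  xsub_is0 (xcomm (ext_ideal E) (xfull_ideal (ext_tot E))).

Definition is_stem_extension (K : fieldType) (N : xmod K)
    (E : extension N) : Prop :=
  is_central_extension E /\
  xsub_le (ext_ideal E)
    (xcomm (xfull_ideal (ext_tot E)) (xfull_ideal (ext_tot E))).

(* P is the free presentation of N from which the Schur multiplier of N is
   computed; E is the extension that is claimed to be a stem cover of N. *)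
Definition is_stem_cover (K : fieldType) (N : xmod K) (P E : extension N) :
  Prop :=
  is_stem_extension E /\
  xisomorphic (ext_ker E) (xmod_of_sub (schur_multiplier P)).

(* 0 -> U/T -> M/T -> N -> 0, for P the extension 0 -> U -> M -> N -> 0 *)
Section QuotientExtension.
Variables (K : fieldType) (N : xmod K) (P : extension N).
Variable (T : xideal (ext_tot P)).
Hypothesis leTU : xsub_le T (ext_ideal P).

Lemma le_xker_proj : xsub_le T (xker (ext_proj P)).
Proof.
have [eq_top eq_base] := ext_exact P; split=> x Tx.
  by rewrite -eq_top; apply: leTU.1.
by rewrite -eq_base; apply: leTU.2.
Qed.

Let ker := xmod_of_sub (xquot_sub T (ext_ideal P)).
Let inc : xhom ker (xquot T) := xsub_inc (xquot_sub T (ext_ideal P)).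
Let proj : xhom (xquot T) N := xquot_lift le_xker_proj.

Lemma quot_ext_inj : xinjective inc.
Proof. by split=> x y /= /val_inj. Qed.

Lemma quot_ext_surj : xsurjective proj.
Proof.
have [top_surj base_surj] := ext_proj_surj P; split=> y.
  have [x <-] := top_surj y; exists (xhom_top (xproj T) x).
  exact: xquot_lift_topE.
have [x <-] := base_surj y; exists (xhom_base (xproj T) x).
exact: xquot_lift_baseE.
Qed.

Lemma quot_ext_exact : xsub_eq (ximage inc (xfull ker)) (xker proj).
Proof.
have [eq_top eq_base] := ext_exact P.
split=> x; apply/idP/idP.
- move=> /in_imspace[[y Uy] _ <-].
  have /in_imspace[z Uz yE] := Uy; rewrite in_kerspace [xhom_top inc _]/= -yE.
  have -> : xhom_top proj (xhom_top (xproj T) z) = xhom_top (ext_proj P) z.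
    exact: xquot_lift_topE.
  by rewrite -in_kerspace -eq_top.
- have [z ->] := xquot_topP x; rewrite in_kerspace => /eqP pz.
  have Uz : z \in xsub_top (ext_ideal P).
    rewrite eq_top in_kerspace -pz; apply/eqP/esym; exact: xquot_lift_topE.
  have Tz : xhom_top (xproj T) z \in xsub_top (xquot_sub T (ext_ideal P)).
    by apply/in_imspace; exists z.
  apply/in_imspace.
  by exists (exist (fun y => y \in xsub_top (xquot_sub T (ext_ideal P))) _ Tz).
- move=> /in_imspace[[y Uy] _ <-].
  have /in_imspace[z Uz yE] := Uy; rewrite in_kerspace [xhom_base inc _]/= -yE.
  have -> : xhom_base proj (xhom_base (xproj T) z) = xhom_base (ext_proj P) z.
    exact: xquot_lift_baseE.
  by rewrite -in_kerspace -eq_base.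
- have [z ->] := xquot_baseP x; rewrite in_kerspace => /eqP pz.
  have Uz : z \in xsub_base (ext_ideal P).
    rewrite eq_base in_kerspace -pz; apply/eqP/esym; exact: xquot_lift_baseE.
  have Tz : xhom_base (xproj T) z \in xsub_base (xquot_sub T (ext_ideal P)).
    by apply/in_imspace; exists z.
  apply/in_imspace.
  by exists (exist (fun y => y \in xsub_base (xquot_sub T (ext_ideal P))) _ Tz).
Qed.

Definition quot_ext : extension N :=
  Extension quot_ext_inj quot_ext_surj quot_ext_exact.

End QuotientExtension.

(* Main.v *)
Require Import Defs.
From mathcomp Require Import all_boot all_order all_algebra.
From HB Require Import structures.
From mathcomp Require Import boolp.

Set Implicit Arguments.
Unset Strict Implicit.
Unset Printing Implicit Defensive.

Import GRing.Theory.
Local Open Scope ring_scope.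

(** Write 0 -> U -> M -> N -> 0 for the free presentation, C = [U,M],
    D = [M,M]; the multiplier is (U /\ D)/C. For T between C and U, the
    decomposition U/C = (U /\ D)/C (+) T/C says that every element of U is
    congruent modulo T to one of U /\ D, and that T meets U /\ D inside C
    ([xdirect_sum_quotP]).

    From a complement to a stem cover: M/T -> N has kernel U/T, which is central
    because C <= T, and lies in [M/T, M/T] because U /\ D surjects onto U/T;
    the same map (U /\ D)/C -> U/T is injective, so U/T is the multiplier.

    From a stem cover 0 -> A -> H -> N -> 0 to a complement: M is projective
    ([free_xmod_projective]), so M -> N lifts to f : M -> H; let T = ker f.
    Since H = f(M) + A with A central, [H,H] = f(D) ([xcomm_full_le_image]), and
    as A <= [H,H] the map f is onto ([lift_surj]) and sends U /\ D onto A.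
    Hence (U /\ D)/C -> A is a surjection between finite-dimensional spaces
    known to be isomorphic, so it is injective ([multiplier_map_inj]). Its
    surjectivity and injectivity are the two halves of the decomposition.

    Projectivity comes from the semidirect product n x| q of a crossed module
    (n, q): with F * F the base of the free object on a set, so that the top is
    the kernel of p2 : F * F -> F, a crossed homomorphism from the free object
    to (n, q) is turned into a Leibniz homomorphism F * F -> n x| q taking the
    first copy of the generators to n and the second to q. As F * F is free on
    the two copies, such a homomorphism is lifted along a surjection generator
    by generator, and two of them agree as soon as they agree on generators. *)

(** * Homomorphisms of Leibniz algebras and of crossed modules *)

Section LeibnizHomomorphisms.
Variable K : fieldType.
Implicit Types L M : leibnizType K.

Section FromLinear.
Variables (L M : leibnizType K) (f : L -> M).
Hypotheses (f_lin : linear f) (f_br : forall x y, f {[x, y]} = {[f x, f y]}).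

Let f_linear : {linear L -> M} :=
  HB.pack f (GRing.isLinear.Build K L M *:%R f f_lin).

Definition lhom_of : lhom L M := @LHom K L M f_linear f_br.

Lemma lhom_ofE x : lhom_of x = f x.
Proof. by []. Qed.

End FromLinear.

Lemma lcomp_br L M H (g : lhom M H) (f : lhom L M) x y :
  (g \o f) {[x, y]} = {[(g \o f) x, (g \o f) y]}.
Proof. by rewrite /= !lhom_br. Qed.

Definition lcomp L M H (g : lhom M H) (f : lhom L M) : lhom L H :=
  @LHom K L H (g \o f) (lcomp_br g f).

Lemma lid_br L (x y : L) : idfun {[x, y]} = {[idfun x, idfun y]} :> L.
Proof. by []. Qed.

Definition lid L : lhom L L := @LHom K L L idfun (@lid_br L).

End LeibnizHomomorphisms.

Section CrossedHomomorphisms.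
Variable K : fieldType.
Implicit Types X Y Z : xmod K.

Definition xid X : xhom X X :=
  @XHom K X X (lid _) (lid _) (fun _ => erefl) (fun _ _ => erefl)
    (fun _ _ => erefl).

Definition xcomp X Y Z (g : xhom Y Z) (f : xhom X Y) : xhom X Z.
Proof.
exists (lcomp (xhom_top g) (xhom_top f)) (lcomp (xhom_base g) (xhom_base f)).
- by move=> n; rewrite /= !xhom_d.
- by move=> q n; rewrite /= !xhom_lact.
- by move=> q n; rewrite /= !xhom_ract.
Defined.

Lemma xsurjective_comp X Y Z (g : xhom Y Z) (f : xhom X Y) :
  xsurjective g -> xsurjective f -> xsurjective (xcomp g f).
Proof.
move=> [gt gb] [ft fb]; split=> z.
  by have [y <-] := gt z; have [x <-] := ft y; exists x.
by have [y <-] := gb z; have [x <-] := fb y; exists x.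
Qed.

Lemma xbijective_inverse X Y (f : xhom X Y) :
    xinjective f -> xsurjective f ->
  exists g : xhom Y X,
    [/\ cancel (xhom_top f) (xhom_top g), cancel (xhom_top g) (xhom_top f),
        cancel (xhom_base f) (xhom_base g) &
        cancel (xhom_base g) (xhom_base f)].
Proof.
move=> [injt injb] [/choice[gt gtK] /choice[gb gbK]].
have gt_lin : linear gt.
  by move=> a x y; apply: injt; rewrite linearP !gtK.
have gb_lin : linear gb.
  by move=> a x y; apply: injb; rewrite linearP !gbK.
have gt_br x y : gt {[x, y]} = {[gt x, gt y]}.
  by apply: injt; rewrite lhom_br !gtK.
have gb_br x y : gb {[x, y]} = {[gb x, gb y]}.
  by apply: injb; rewrite lhom_br !gbK.
have gd n : lhom_of gb_lin gb_br (xd Y n) = xd X (lhom_of gt_lin gt_br n).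
  by apply: injb; rewrite xhom_d !lhom_ofE gtK gbK.
have gl q n : lhom_of gt_lin gt_br (xlact Y q n)
    = xlact X (lhom_of gb_lin gb_br q) (lhom_of gt_lin gt_br n).
  by apply: injt; rewrite xhom_lact !lhom_ofE !gtK gbK.
have gr q n : lhom_of gt_lin gt_br (xract Y n q)
    = xract X (lhom_of gt_lin gt_br n) (lhom_of gb_lin gb_br q).
  by apply: injt; rewrite xhom_ract !lhom_ofE !gtK gbK.
exists (XHom gd gl gr); split=> x /=; rewrite ?gtK ?gbK //.
  by apply: injt; rewrite gtK.
by apply: injb; rewrite gbK.
Qed.

Lemma xbijective_iso X Y (f : xhom X Y) :
  xinjective f -> xsurjective f -> xisomorphic X Y.
Proof. by move=> inj surj; exists f; apply: xbijective_inverse. Qed.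

Lemma xisomorphic_sym X Y : xisomorphic X Y -> xisomorphic Y X.
Proof. by move=> [f [g [? ? ? ?]]]; exists g, f. Qed.

Lemma xisomorphic_trans X Y Z :
  xisomorphic X Y -> xisomorphic Y Z -> xisomorphic X Z.
Proof.
move=> [f [f' [? ? ? ?]]] [g [g' [? ? ? ?]]].
by exists (xcomp g f), (xcomp f' g'); split; apply: can_comp.
Qed.

Lemma xisomorphic_bij X Y :
  xisomorphic X Y -> exists2 f : xhom X Y, xinjective f & xsurjective f.
Proof.
move=> [f [g [ftK gtK fbK gbK]]]; exists f; first by split; apply: can_inj.
by split=> y; [exists (xhom_top g y) | exists (xhom_base g y)].
Qed.

End CrossedHomomorphisms.

(** * Sub crossed modules *)

Section SubCrossedModules.
Variable K : fieldType.
Implicit Types X Y : xmod K.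

Section Corestriction.
Variables (X Y : xmod K) (f : xhom X Y) (S : xsub Y).
Hypothesis fS : xsub_le (ximage f (xfull X)) S.

Lemma xcorestrict_top_in x : xhom_top f x \in xsub_top S.
Proof. by apply: fS.1; apply/in_imspace; exists x. Qed.
Lemma xcorestrict_base_in x : xhom_base f x \in xsub_base S.
Proof. by apply: fS.2; apply/in_imspace; exists x. Qed.

Let ftop (x : xtop X) : xtop (xmod_of_sub S) :=
  exist _ (xhom_top f x) (xcorestrict_top_in x).
Let fbase (x : xbase X) : xbase (xmod_of_sub S) :=
  exist _ (xhom_base f x) (xcorestrict_base_in x).

Lemma xcorestrict_top_lin : linear ftop.
Proof. by move=> a u v; apply: val_inj; rewrite /= linearP. Qed.
Lemma xcorestrict_base_lin : linear fbase.
Proof. by move=> a u v; apply: val_inj; rewrite /= linearP. Qed.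
Lemma xcorestrict_top_br x y : ftop {[x, y]} = {[ftop x, ftop y]}.
Proof. by apply: val_inj; rewrite /= lhom_br. Qed.
Lemma xcorestrict_base_br x y : fbase {[x, y]} = {[fbase x, fbase y]}.
Proof. by apply: val_inj; rewrite /= lhom_br. Qed.

Definition xcorestrict : xhom X (xmod_of_sub S).
Proof.
exists (lhom_of xcorestrict_top_lin xcorestrict_top_br)
       (lhom_of xcorestrict_base_lin xcorestrict_base_br).
- by move=> n; apply: val_inj; rewrite /= xhom_d.
- by move=> q n; apply: val_inj; rewrite /= xhom_lact.
- by move=> q n; apply: val_inj; rewrite /= xhom_ract.
Defined.

End Corestriction.

Lemma xcorestrict_surj X Y (f : xhom X Y) (S : xsub Y)
    (fS : xsub_le (ximage f (xfull X)) S) :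
  xsub_le S (ximage f (xfull X)) -> xsurjective (xcorestrict fS).
Proof.
move=> [St Sb]; split=> y.
  have /in_imspace[x _ fx] := St _ (valP y).
  by exists x; apply: val_inj.
have /in_imspace[x _ fx] := Sb _ (valP y).
by exists x; apply: val_inj.
Qed.

Lemma xcorestrict_inj X Y (f : xhom X Y) (S : xsub Y)
    (fS : xsub_le (ximage f (xfull X)) S) :
  xinjective f -> xinjective (xcorestrict fS).
Proof.
by move=> [it ib]; split=> x y /(congr1 val) /=; [apply: it | apply: ib].
Qed.

Lemma xsub_eq_le X (S T : xsub X) : xsub_eq S T -> xsub_le S T /\ xsub_le T S.
Proof. by move=> [et eb]; split; split=> x; rewrite ?et ?eb. Qed.

Lemma ximage_iso X Y (f : xhom X Y) (S : xsub Y) :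
    xinjective f -> xsub_eq (ximage f (xfull X)) S ->
  xisomorphic X (xmod_of_sub S).
Proof.
move=> inj /xsub_eq_le[le1 le2].
apply: (xbijective_iso (f := xcorestrict le1)).
  exact: xcorestrict_inj.
exact: xcorestrict_surj.
Qed.

Lemma ximage_xsub_inc X (S : xsub X) :
  xsub_eq (ximage (xsub_inc S) (xfull (xmod_of_sub S))) S.
Proof.
split=> x; apply/idP/idP => [/in_imspace[y _ <-]|Sx]; first exact: (valP y).
- by apply/in_imspace; exists (exist (fun z => z \in xsub_top S) x Sx).
- exact: (valP y).
- by apply/in_imspace; exists (exist (fun z => z \in xsub_base S) x Sx).
Qed.

Lemma xker_is_ideal X Y (f : xhom X Y) : is_crossed_ideal (xker f).
Proof. by exists Y, f. Qed.

Definition xker_ideal X Y (f : xhom X Y) : xideal X := XIdeal (xker_is_ideal f).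

Lemma in_xquot_top X (I : xideal X) n :
  (xhom_top (xproj I) n == 0) = (n \in xsub_top I).
Proof. by rewrite -(linear0 (xhom_top (xproj I))) eq_quot_pi subr0. Qed.

Lemma in_xquot_base X (I : xideal X) q :
  (xhom_base (xproj I) q == 0) = (q \in xsub_base I).
Proof. by rewrite -(linear0 (xhom_base (xproj I))) eq_quot_pi subr0. Qed.

End SubCrossedModules.

(** * Commutators *)

Section Commutators.
Variable K : fieldType.
Implicit Types X Y : xmod K.

(** Every commutator inclusion, centrality included (R = 0), is handled
    through this elementwise form: see [xcomm_leP]. *)
Record commutes_into X (S T R : xsub X) : Prop := CommutesInto {
  commutes_br : forall p q, p \in xsub_base S -> q \in xsub_base T ->
    {[p, q]} \in xsub_base R /\ {[q, p]} \in xsub_base R;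
  commutes_act : forall q n, q \in xsub_base S -> n \in xsub_top T ->
    xlact X q n \in xsub_top R /\ xract X n q \in xsub_top R;
  commutes_act' : forall q n, q \in xsub_base T -> n \in xsub_top S ->
    xlact X q n \in xsub_top R /\ xract X n q \in xsub_top R
}.

Lemma xcomm_leP X (S T : xideal X) (R : xsub X) :
  xsub_le (xcomm S T) R <-> commutes_into S T R.
Proof.
split=> [[let0 leb]|[br act act']].
  split=> [p q Sp Tq|q n Sq Tn|q n Tq Sn].
  - by split; apply: leb; apply: mem_spanspace; exists p, q; split; auto.
  - by split; apply: let0; apply: mem_spanspace; left; exists q, n; split; auto.
  - by split; apply: let0; apply: mem_spanspace; right; exists q, n;
      split; auto.
split; apply: spanspace_min => x.
  by case=> -[q [n [Hq Hn [->|->]]]]; 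
    first [case: (act q n Hq Hn) | case: (act' q n Hq Hn)].
by move=> [p [q [Sp Tq [->|->]]]]; case: (br p q).
Qed.

Definition xzero X : xsub X := xker (xid X).

Lemma xsub_is0P X (S : xsub X) : xsub_is0 S <-> xsub_le S (xzero X).
Proof.
split=> -[top base]; split=> x Sx.
- by apply/eqP/top.
- by apply/eqP/base.
- by apply/eqP/top.
- by apply/eqP/base.
Qed.

Lemma in_xzero_top X n : (n \in xsub_top (xzero X)) = (n == 0).
Proof. by []. Qed.
Lemma in_xzero_base X q : (q \in xsub_base (xzero X)) = (q == 0).
Proof. by []. Qed.

Lemma xcomm_full_map X Y (f : xhom X Y) :
  xsub_le (ximage f (xcomm (xfull_ideal X) (xfull_ideal X)))
          (xcomm (xfull_ideal Y) (xfull_ideal Y)).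
Proof.
have /xcomm_leP[br act _] : xsub_le (xcomm (xfull_ideal Y) (xfull_ideal Y))
    (xcomm (xfull_ideal Y) (xfull_ideal Y)) by split.
split=> _ /in_imspace[x Dx <-].
  have lin : linear (xhom_top f) by apply: linearP.
  apply: (span_preimage lin) Dx => _ [] [q [n [_ _ [->|->]]]];
    rewrite ?xhom_lact ?xhom_ract;
    exact: (proj1 (act _ _ isT isT)) || exact: (proj2 (act _ _ isT isT)).
have lin : linear (xhom_base f) by apply: linearP.
apply: (span_preimage lin) Dx => _ [p [q [_ _ [->|->]]]]; rewrite lhom_br;
  exact: (proj1 (br _ _ isT isT)).
Qed.

End Commutators.

(** * Semidirect products *)

(** The abelian-group bookkeeping of the Leibniz identity [sd_brA] below: the
    mixed terms s, t, u, v occur in both halves of the right-hand side. *)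
Lemma sd_assoc_cancel (V : zmodType) (a a' c c' d d' e e' f f' s t u v : V) :
  a - a' - c' + c + (d - d' + e + e') + (f - f') =
  a + d + s + (e + t) + (u + c + v + f)
    - (a' + d' + u + (- e' + v) + (s + c' + t + f')).
Proof.
rewrite !addrA [X in _ = X - _](ACl ((1*7*2*4*9)*(3*5*6*8))).
rewrite [X in _ = _ - X](ACl ((1*7*2*4*9)*(6*8*3*5))) /=.
rewrite [in RHS]opprD [RHS]addrACA subrr addr0 !opprD opprK !addrA.
by rewrite [LHS](ACl (1*4*5*7*9*2*3*6*8*10)).
Qed.

Section SemidirectProduct.
Variables (K : fieldType) (X : xmod K).

Definition semidirect := (xtop X * xbase X)%type.
HB.instance Definition _ := GRing.Lmodule.on semidirect.

Definition sd_br (u v : semidirect) : semidirect :=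
  ({[u.1, v.1]} + xlact X u.2 v.1 + xract X u.1 v.2, {[u.2, v.2]}).

Lemma sd_br_bilinear : bilinear_for *:%R *:%R sd_br.
Proof.
split=> [v|u] a x y; apply: injective_projections;
  rewrite /= ?linearPl ?linearPr //.
- by rewrite !scalerDr [RHS]addrACA; congr (_ + _); apply: addrACA.
- by rewrite !scalerDr [RHS]addrACA; congr (_ + _); apply: addrACA.
Qed.
HB.instance Definition _ :=
  bilinear_isBilinear.Build K _ _ _ _ _ sd_br sd_br_bilinear.

Lemma sd_brA u v w :
  sd_br u (sd_br v w) = sd_br (sd_br u v) w - sd_br (sd_br u w) v.
Proof.
case: u v w => [n1 q1] [n2 q2] [n3 q3].
apply: injective_projections; rewrite /=; last exact: lbrA.
rewrite !(linearDl, linearDr) /=.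
rewrite !(lact_brl, lact_brr, ract_brr, ract_brl).
rewrite lbrA br_lact [xlact X q1 (xlact X q3 n2)]lact_lact.
exact: sd_assoc_cancel.
Qed.
HB.instance Definition _ := isLeibniz.Build K semidirect sd_brA.

Definition sd_proj : lhom semidirect (xbase X) :=
  @lhom_of K semidirect (xbase X) snd (fun _ _ _ => erefl) (fun _ _ => erefl).

Definition sd_total_fun (u : semidirect) : xbase X := xd X u.1 + u.2.

Lemma sd_total_lin : linear sd_total_fun.
Proof.
by move=> a u v; rewrite /sd_total_fun /= linearP scalerDr addrACA.
Qed.
Lemma sd_total_br u v :
  sd_total_fun {[u, v]} = {[sd_total_fun u, sd_total_fun v]}.
Proof.
rewrite /sd_total_fun /= !linearD /= lhom_br xd_lact xd_ract.
by rewrite !(linearDl, linearDr) /= !addrA.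
Qed.

(** Multiplicative by the two crossed module identities for the boundary. For a
    homomorphism h into the semidirect product that sends an ideal to the
    top, [sd_total] after h is the base component of a crossed homomorphism
    whose top component is the first coordinate of h. *)
Definition sd_total : lhom semidirect (xbase X) :=
  lhom_of sd_total_lin sd_total_br.

End SemidirectProduct.

Section SemidirectMap.
Variables (K : fieldType) (X Y : xmod K) (f : xhom X Y).

Definition sd_map_fun (u : semidirect X) : semidirect Y :=
  (xhom_top f u.1, xhom_base f u.2).

Lemma sd_map_lin : linear sd_map_fun.
Proof. by move=> a u v; congr pair; rewrite /= linearP. Qed.
Lemma sd_map_br u v : sd_map_fun {[u, v]} = {[sd_map_fun u, sd_map_fun v]}.
Proof.
apply: injective_projections; rewrite /= ?lhom_br //.
by rewrite !linearD /= lhom_br xhom_lact xhom_ract.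
Qed.
Definition sd_map : lhom (semidirect X) (semidirect Y) :=
  lhom_of sd_map_lin sd_map_br.

End SemidirectMap.

(** * Free crossed modules are projective *)

Section FreeCrossedModule.
Variables (K : fieldType) (X : Type) (F C : leibnizType K) (i : X -> F).
Variables (i1 i2 : lhom F C) (p2 : lhom C F).
Hypotheses (F_free : is_free_leibniz i) (C_coprod : is_leibniz_coproduct i1 i2).
Hypotheses (p2i1 : forall x, p2 (i1 x) = 0) (p2i2 : forall x, p2 (i2 x) = x).

(** F * F is free on two copies of X: uniqueness here, existence in
    [coproduct_hom_ex]. *)
Lemma coproduct_hom_eq (L : leibnizType K) (u v : lhom C L) :
    (forall x, u (i1 (i x)) = v (i1 (i x))) ->
    (forall x, u (i2 (i x)) = v (i2 (i x))) ->
  u =1 v.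
Proof.
have ext (j : lhom F C) : (forall x, u (j (i x)) = v (j (i x))) ->
    forall y, u (j y) = v (j y).
  move=> uv y; have [g _ gU] := F_free (fun x => v (j (i x))).
  exact: etrans (gU (lcomp u j) uv y)
                (esym (gU (lcomp v j) (fun=> erefl) y)).
move=> /ext uv1 /ext uv2 c.
have [h _ hU] := C_coprod (lcomp v i1) (lcomp v i2).
by rewrite [LHS]hU // [RHS]hU.
Qed.

Lemma coproduct_hom_ex (L : leibnizType K) (a b : X -> L) :
  exists2 h : lhom C L,
    forall x, h (i1 (i x)) = a x & forall x, h (i2 (i x)) = b x.
Proof.
have [[ga gaE _] [gb gbE _]] := (F_free a, F_free b).
have [h [h1 h2] _] := C_coprod ga gb.
by exists h => x; rewrite ?h1 ?h2.
Qed.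

Local Notation FX := (incl_xmod (Defs.lker p2)).

Lemma ker_part_in c : c - i2 (p2 c) \in Defs.lker p2.
Proof. by rewrite in_kerspace linearB /= p2i2 subrr. Qed.

(** The projection to the kernel of p2 along the complement i2(F); it exhibits
    F * F as the semidirect product of that kernel by F. *)
Definition ker_part (c : C) : incl_top (Defs.lker p2) :=
  exist _ (c - i2 (p2 c)) (ker_part_in c).

Lemma ker_part_id (c : incl_top (Defs.lker p2)) : ker_part (val c) = c.
Proof.
apply: val_inj => /=; have /eqP-> := valP c.
by rewrite linear0 subr0.
Qed.

Lemma ker_part_i2 y : ker_part (i2 y) = 0.
Proof. by apply: val_inj; rewrite /= p2i2 subrr. Qed.

Lemma ker_part_lin : linear ker_part.
Proof.
move=> a u v; apply: val_inj; rewrite /= !linearP /=.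
by rewrite addrACA scalerDr.
Qed.

Lemma ker_part_br u v :
  ker_part {[u, v]} = {[ker_part u, ker_part v]}
    + xlact FX (i2 (p2 u)) (ker_part v) + xract FX (ker_part u) (i2 (p2 v)).
Proof.
apply: val_inj; rewrite /= !lhom_br.
have -> : {[u, v]} = {[u - i2 (p2 u) + i2 (p2 u), v - i2 (p2 v) + i2 (p2 v)]}.
  by rewrite !subrK.
move: (u - i2 (p2 u)) (v - i2 (p2 v)) => k l.
rewrite linearDl !linearDr /= !addrA addrK.
by rewrite addrAC.
Qed.

Section Split.
Variables (Y : xmod K) (g : xhom FX Y).

(** The crossed homomorphism g read on F * F through the splitting by
    [ker_part]; g is recovered from it, on the kernel by the first coordinate
    ([free_split_ker]) and on the base by [sd_total] ([free_split_total]). *)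
Definition free_split_fun (c : C) : semidirect Y :=
  (xhom_top g (ker_part c), xhom_base g (i2 (p2 c))).

Lemma free_split_lin : linear free_split_fun.
Proof.
move=> a u v; apply: injective_projections; last by rewrite /= !linearP.
by rewrite /= ker_part_lin linearP.
Qed.

Lemma free_split_br u v :
  free_split_fun {[u, v]} = {[free_split_fun u, free_split_fun v]}.
Proof.
apply: injective_projections; last by rewrite /= !lhom_br.
rewrite /= ker_part_br !linearD. rewrite lhom_br.
rewrite (xhom_lact g (i2 (p2 u)) (ker_part v)).
by rewrite (xhom_ract g (i2 (p2 v)) (ker_part u)).
Qed.

Definition free_split : lhom C (semidirect Y) :=
  lhom_of free_split_lin free_split_br.

Lemma free_split_ker (c : incl_top (Defs.lker p2)) :
  free_split (val c) = (xhom_top g c, 0).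
Proof.
rewrite lhom_ofE /free_split_fun ker_part_id.
by have /eqP-> := valP c; rewrite !linear0.
Qed.

Lemma free_split_total c : sd_total Y (free_split c) = xhom_base g c.
Proof.
rewrite !lhom_ofE /sd_total_fun /= -(xhom_d g (ker_part c)) -linearD /=.
by rewrite subrK.
Qed.

End Split.

Section FromHom.
Variables (Z : xmod K) (h : lhom C (semidirect Z)).
Hypothesis h_i1 : forall x, (h (i1 (i x))).2 = 0.

(** The composite of h with the projection to the base kills i1(F), hence
    factors through p2. *)
Lemma from_hom_ker (c : incl_top (Defs.lker p2)) : (h (val c)).2 = 0.
Proof.
pose v := lcomp (sd_proj Z) h.
have := @coproduct_hom_eq _ v (lcomp v (lcomp i2 p2)).
move=> /(_ _ _ (val c)) /= -> //.
- by have /eqP-> := valP c; rewrite !linear0.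
- by move=> x; rewrite h_i1 p2i1 !linear0.
- by move=> x; rewrite p2i2.
Qed.

Let from_top (c : incl_top (Defs.lker p2)) : xtop Z := (h (val c)).1.

Lemma from_top_lin : linear from_top.
Proof. by move=> a u v; rewrite /from_top !linearP. Qed.

Lemma from_top_br u v : from_top {[u, v]} = {[from_top u, from_top v]}.
Proof.
rewrite /from_top /= lhom_br /= !from_hom_ker.
by rewrite linear0l linear0r !addr0.
Qed.

Definition xhom_of_sd : xhom FX Z.
Proof.
exists (lhom_of from_top_lin from_top_br) (lcomp (sd_total Z) h).
- by move=> n; rewrite /= /sd_total_fun from_hom_ker addr0.
- move=> q n; rewrite /= /from_top lhom_br /= from_hom_ker linear0r addr0.
  by rewrite /sd_total_fun linearDl /= lact_xd.
- move=> q n; rewrite /= /from_top lhom_br /= from_hom_ker linear0l addr0.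
  by rewrite /sd_total_fun linearDr /= ract_xd.
Defined.
End FromHom.

(** The generators are lifted one by one to get h; that h lies over the whole
    of [free_split g], and so that the crossed homomorphism made from it lies
    over g, needs to be checked only on generators. *)
Lemma free_xmod_lift (Y Z : xmod K) (s : xhom Z Y) (g : xhom FX Y) :
    xsurjective s ->
  exists l : xhom FX Z,
    (forall n, xhom_top s (xhom_top l n) = xhom_top g n) /\
    (forall q, xhom_base s (xhom_base l q) = xhom_base g q).
Proof.
move=> [/choice[st stK] /choice[sb sbK]].
have [h h1 h2] := @coproduct_hom_ex (semidirect Z)
  (fun x => (st (free_split g (i1 (i x))).1, 0))
  (fun x => (0, sb (free_split g (i2 (i x))).2)).
have hE : lcomp (sd_map s) h =1 free_split g.
  apply: coproduct_hom_eq => x.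
    rewrite [LHS]/= h1; apply: injective_projections; first exact: stK.
    by rewrite /= p2i1 !linear0.
  rewrite [LHS]/= h2; apply: injective_projections; last exact: sbK.
  by rewrite /= ker_part_i2 !linear0.
have h_i1 x : (h (i1 (i x))).2 = 0 by rewrite h1.
exists (xhom_of_sd h_i1); split=> [n|q].
  by rewrite -[RHS]/(xhom_top g n, 0 : xbase Y).1 -free_split_ker -hE.
have := congr1 (sd_total Y) (hE q).
rewrite free_split_total => <-; rewrite /= /sd_total_fun /=.
by rewrite linearD /= xhom_d.
Qed.

End FreeCrossedModule.

Lemma free_xmod_projective (K : fieldType) (M Y Z : xmod K) (s : xhom Z Y)
    (g : xhom M Y) :
    is_free_xmod M -> xsurjective s ->
  exists l : xhom M Z,
    (forall n, xhom_top s (xhom_top l n) = xhom_top g n) /\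
    (forall q, xhom_base s (xhom_base l q) = xhom_base g q).
Proof.
move=> [X [F [C [i [i1 [i2 [p2 [F_free C_coprod p2i1 p2i2 isoM]]]]]]]] surj.
have [e [e' [eK _ ebK _]]] := isoM.
have [l [lt lb]] :=
  free_xmod_lift F_free C_coprod p2i1 p2i2 (xcomp g e') surj.
exists (xcomp l e); split=> x.
  by rewrite /= lt /= eK.
by rewrite /= lb /= ebK.
Qed.

(** * Finite dimension *)

Lemma fd_surj_inj (K : fieldType) (V : lmodType K) (h : {linear V -> V}) :
  finite_dimensional_space V -> (forall y, exists x, h x = y) -> injective h.
Proof.
move=> [n [[v2r v2r_lin [r2v v2rK r2vK]]]] h_surj.
have r2v_lin : linear r2v.
  by move=> a x y; apply: (can_inj v2rK); rewrite v2r_lin !r2vK.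
have g_lin : linear (v2r \o h \o r2v).
  by move=> a x y; rewrite /= r2v_lin linearP v2r_lin.
pose g : {linear 'rV[K]_n -> 'rV[K]_n} := HB.pack (v2r \o h \o r2v)
  (GRing.isLinear.Build K 'rV[K]_n 'rV[K]_n *:%R (v2r \o h \o r2v) g_lin).
have [s sK] := choice h_surj.
have /row_free_inj g_inj : row_free (lin1_mx g).
  rewrite row_free_unit -row_full_unit; apply/row_fullP.
  exists (\matrix_i v2r (s (r2v (row i 1%:M)))).
  apply/row_matrixP => i; rewrite row_mul rowK mul_rV_lin1 /=.
  by rewrite v2rK sK r2vK.
move=> x y hxy; apply: (can_inj v2rK); apply: g_inj.
by rewrite !mul_rV_lin1 /= !v2rK hxy.
Qed.

Lemma xfd_surj_inj (K : fieldType) (X Y : xmod K) (f : xhom X Y) :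
  xfinite_dimensional X -> xisomorphic Y X -> xsurjective f -> xinjective f.
Proof.
move=> [fdt fdb] /xisomorphic_bij[e _ e_surj] f_surj.
have [surjt surjb] := xsurjective_comp e_surj f_surj.
split=> x y fxy.
  by apply: (fd_surj_inj (h := xhom_top (xcomp e f)) fdt surjt); rewrite /= fxy.
by apply: (fd_surj_inj (h := xhom_base (xcomp e f)) fdb surjb); rewrite /= fxy.
Qed.

(** * Complements in a quotient *)

Section ComplementModulo.
Variables (K : fieldType) (V : lmodType K).

(** T/C is a complement of (U /\ D)/C in U/C, said with elements of V. *)
Definition complement_mod (U D T C : subspace V) : Prop :=
  (forall u, u \in U -> exists2 d, d \in capspace U D & u - d \in T) /\
  (forall d, d \in capspace U D -> d \in T -> d \in C).

Lemma quot_direct_sumP (U D T C : subspace V)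
    (A := imspace (quot_pi C) (capspace U D)) (B := imspace (quot_pi C) T) :
    {subset C <= T} -> {subset T <= U} ->
  ((forall n, n \in imspace (quot_pi C) U <->
      exists a b, [/\ a \in A, b \in B & n = a + b]) /\
   (forall n, n \in A -> n \in B -> n = 0))
  <-> complement_mod U D T C.
Proof.
move=> leCT leTU; split=> [] [sum cap]; split.
- move=> u Uu; have /sum[_ [_ [/in_imspace[d Dd <-] /in_imspace[t Tt <-]]]] :
    quot_pi C u \in imspace (quot_pi C) U by apply/in_imspace; exists u.
  rewrite -linearD => /eqP; rewrite eq_quot_pi opprD addrA => /leCT Tudt.
  by exists d => //; rewrite -(subrK t (u - d)) rpredD.
- move=> d Dd Td; have /eqP : quot_pi C d = 0.
    by apply: cap; apply/in_imspace; exists d.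
  by rewrite -(linear0 (quot_pi C)) eq_quot_pi subr0.
- move=> n; split=> [/in_imspace[u /sum[d Dd Tud] <-]|].
    exists (quot_pi C d), (quot_pi C (u - d)).
    split; first by apply/in_imspace; exists d.
      by apply/in_imspace; exists (u - d).
    by rewrite -linearD addrC subrK.
  move=> [_ [_ [/in_imspace[d /andP[Ud _] <-] /in_imspace[t /leTU Ut <-] ->]]].
  by apply/in_imspace; exists (d + t); rewrite ?rpredD ?linearD.
- move=> _ /in_imspace[d Dd <-] /in_imspace[t Tt] /eqP.
  rewrite eq_quot_pi => /leCT Ttd.
  have Td : d \in T by rewrite -[d](subKr t) rpredB.
  by apply/eqP; rewrite -(linear0 (quot_pi C)) eq_quot_pi subr0 cap.
Qed.

End ComplementModulo.

Section ComplementModuloCrossed.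
Variables (K : fieldType) (X : xmod K) (C T : xideal X) (U D : xsub X).
Hypotheses (leCT : xsub_le C T) (leTU : xsub_le T U).

Definition xcomplement_mod : Prop :=
  complement_mod (xsub_top U) (xsub_top D) (xsub_top T) (xsub_top C) /\
  complement_mod (xsub_base U) (xsub_base D) (xsub_base T) (xsub_base C).

Lemma xdirect_sum_quotP :
  xdirect_sum (xquot_sub C U) (xquot_sub C (xcap U D)) (xquot_sub C T)
  <-> xcomplement_mod.
Proof.
split=> [[st ct sb cb]|[/(quot_direct_sumP _ leCT.1 leTU.1)[st ct]
                        /(quot_direct_sumP _ leCT.2 leTU.2)[sb cb]]].
  split.
    by apply/quot_direct_sumP; [exact: leCT.1 | exact: leTU.1 | split].
  by apply/quot_direct_sumP; [exact: leCT.2 | exact: leTU.2 | split].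
by split.
Qed.

End ComplementModuloCrossed.

(** * Central extensions *)

Section Extensions.
Variable K : fieldType.

Lemma ext_ideal_top (N : xmod K) (P : extension N) n :
  (n \in xsub_top (ext_ideal P)) = (xhom_top (ext_proj P) n == 0).
Proof. by rewrite (ext_exact P).1. Qed.

Lemma ext_ideal_base (N : xmod K) (P : extension N) q :
  (q \in xsub_base (ext_ideal P)) = (xhom_base (ext_proj P) q == 0).
Proof. by rewrite (ext_exact P).2. Qed.

Lemma xinjective_ker (X Y : xmod K) (f : xhom X Y) :
  xsub_is0 (xker f) -> xinjective f.
Proof.
move=> [kt kb]; split=> x y fxy; apply/eqP; rewrite -subr_eq0; apply/eqP.
  by apply: kt; rewrite in_kerspace linearB fxy subrr.
by apply: kb; rewrite in_kerspace linearB fxy subrr.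
Qed.

Lemma le_xker_xproj (X : xmod K) (C T : xideal X) :
  xsub_le C T -> xsub_le C (xker (xproj T)).
Proof.
move=> [let0 leb]; split=> x Cx; first by rewrite in_kerspace in_xquot_top let0.
by rewrite in_kerspace in_xquot_base leb.
Qed.

Lemma is_central_extensionP (N : xmod K) (E : extension N) :
  is_central_extension E <->
  commutes_into (ext_ideal E) (xfull (ext_tot E)) (xzero _).
Proof. by rewrite -(xcomm_leP (ext_ideal E) (xfull_ideal _)) -xsub_is0P. Qed.

(** Adding central elements to the arguments changes no bracket and no action,
    so a homomorphism that is surjective up to a central ideal already reaches
    the whole commutator. *)
Lemma xcomm_full_le_image (X Y : xmod K) (f : xhom X Y) (Z : xsub Y) :
    commutes_into Z (xfull Y) (xzero Y) ->
    (forall n, exists m, n - xhom_top f m \in xsub_top Z) ->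
    (forall q, exists p, q - xhom_base f p \in xsub_base Z) ->
  xsub_le (xcomm (xfull_ideal Y) (xfull_ideal Y))
          (ximage f (xcomm (xfull_ideal X) (xfull_ideal X))).
Proof.
move=> [br act act'] ft fb.
have [brD actD _] : commutes_into (xfull X) (xfull X)
    (xcomm (xfull_ideal X) (xfull_ideal X)).
  by apply/(xcomm_leP (xfull_ideal X) (xfull_ideal X)); split.
have act_eq q n p m : n - xhom_top f m \in xsub_top Z ->
    q - xhom_base f p \in xsub_base Z ->
    xlact Y q n = xhom_top f (xlact X p m) /\
    xract Y n q = xhom_top f (xract X m p).
  move=> Zn Zq.
  have [/eqP/= l1 /eqP/= r1] := act _ n Zq isT.
  have [/eqP/= l2 /eqP/= r2] := act' (xhom_base f p) _ isT Zn.
  rewrite xhom_lact xhom_ract -(subrK (xhom_base f p) q) linearDl linearDr /=.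
  rewrite l1 r1 !add0r; split; apply/eqP; rewrite -subr_eq0.
    by rewrite -linearBr l2.
  by rewrite -linearBl r2.
have br_eq q q' p p' : q - xhom_base f p \in xsub_base Z ->
    q' - xhom_base f p' \in xsub_base Z ->
    {[q, q']} = xhom_base f {[p, p']}.
  move=> Zq Zq'.
  have [/eqP/= b1 _] := br _ q' Zq isT.
  have [_ /eqP/= b2] := br _ (xhom_base f p) Zq' isT.
  rewrite lhom_br -(subrK (xhom_base f p) q) linearDl /= b1 add0r.
  by apply/eqP; rewrite -subr_eq0 -linearBr b2.
apply/xcomm_leP; split=> [q q' _ _|q n _ _|q n _ _].
- have [[p Zp] [p' Zp']] := (fb q, fb q').
  rewrite (br_eq _ _ _ _ Zp Zp') (br_eq _ _ _ _ Zp' Zp).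
  have [Dl Dr] := brD p p' isT isT.
  by split; apply/in_imspace; [exists {[p, p']} | exists {[p', p]}].
- have [[m Zm] [p Zp]] := (ft n, fb q).
  have [-> ->] := act_eq _ _ _ _ Zm Zp; have [Dl Dr] := actD p m isT isT.
  by split; apply/in_imspace; [exists (xlact X p m) | exists (xract X m p)].
- have [[m Zm] [p Zp]] := (ft n, fb q).
  have [-> ->] := act_eq _ _ _ _ Zm Zp; have [Dl Dr] := actD p m isT isT.
  by split; apply/in_imspace; [exists (xlact X p m) | exists (xract X m p)].
Qed.

End Extensions.

(** * Maps out of a subquotient *)

Section SubquotientMap.
Variables (K : fieldType) (X Y : xmod K) (C : xideal X) (S : xsub X).
Variables (f : xhom X Y) (leCf : xsub_le C (xker f)).
Local Notation SC := (xmod_of_sub (xquot_sub C S)).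

(** The map S/C -> Y induced by f. With S = U /\ D it is the comparison of
    the multiplier with the kernel of an extension, in both directions of the
    correspondence. *)
Definition subquot_map : xhom SC Y :=
  xcomp (xquot_lift leCf) (xsub_inc (xquot_sub C S)).

Lemma subquot_topP (x : xtop SC) :
  exists2 d, d \in xsub_top S & val x = xhom_top (xproj C) d.
Proof. by have /in_imspace[d Sd dx] := valP x; exists d. Qed.

Lemma subquot_baseP (x : xbase SC) :
  exists2 d, d \in xsub_base S & val x = xhom_base (xproj C) d.
Proof. by have /in_imspace[d Sd dx] := valP x; exists d. Qed.

Lemma subquot_map_topE x d :
  val x = xhom_top (xproj C) d -> xhom_top subquot_map x = xhom_top f d.
Proof.
move=> xd; rewrite -(xquot_lift_topE leCf d).
by rewrite -xd.
Qed.

Lemma subquot_map_baseE x d :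
  val x = xhom_base (xproj C) d -> xhom_base subquot_map x = xhom_base f d.
Proof.
move=> xd; rewrite -(xquot_lift_baseE leCf d).
by rewrite -xd.
Qed.

Lemma subquot_top_ex d : d \in xsub_top S ->
  exists x : xtop SC, val x = xhom_top (xproj C) d.
Proof.
move=> Sd; have Cd : xhom_top (xproj C) d \in xsub_top (xquot_sub C S).
  by apply/in_imspace; exists d.
by exists (exist (fun y => y \in xsub_top (xquot_sub C S)) _ Cd).
Qed.

Lemma subquot_base_ex d : d \in xsub_base S ->
  exists x : xbase SC, val x = xhom_base (xproj C) d.
Proof.
move=> Sd; have Cd : xhom_base (xproj C) d \in xsub_base (xquot_sub C S).
  by apply/in_imspace; exists d.
by exists (exist (fun y => y \in xsub_base (xquot_sub C S)) _ Cd).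
Qed.

Lemma subquot_map_image :
  xsub_eq (ximage subquot_map (xfull SC)) (ximage f S).
Proof.
split=> y; apply/idP/idP => /in_imspace[x]; move=> Sx <-; apply/in_imspace.
- by have [d Sd /subquot_map_topE->] := subquot_topP x; exists d.
- by have [z /subquot_map_topE zx] := subquot_top_ex Sx; exists z.
- by have [d Sd /subquot_map_baseE->] := subquot_baseP x; exists d.
- by have [z /subquot_map_baseE zx] := subquot_base_ex Sx; exists z.
Qed.

Lemma subquot_map_injP : xinjective subquot_map <-> xsub_le (xcap S (xker f)) C.
Proof.
split=> [[injt injb]|[leSt leSb]].
  split=> d /andP[Sd /eqP fd].
    have [x xd] := subquot_top_ex Sd; rewrite -in_xquot_top -xd.
    have -> : x = 0; last by rewrite linear0.
    by apply: injt; rewrite (subquot_map_topE xd) fd linear0.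
  have [x xd] := subquot_base_ex Sd; rewrite -in_xquot_base -xd.
  have -> : x = 0; last by rewrite linear0.
  by apply: injb; rewrite (subquot_map_baseE xd) fd linear0.
apply: xinjective_ker; split=> x.
  have [d Sd xd] := subquot_topP x.
  rewrite in_kerspace (subquot_map_topE xd) => fd.
  by apply/val_inj/eqP; rewrite xd linear0 in_xquot_top leSt //; apply/andP.
have [d Sd xd] := subquot_baseP x.
rewrite in_kerspace (subquot_map_baseE xd) => fd.
by apply/val_inj/eqP; rewrite xd linear0 in_xquot_base leSb //; apply/andP.
Qed.

End SubquotientMap.

(** * Stem covers from complements of the multiplier *)

Section ComplementGivesStemCover.
Variables (K : fieldType) (N : xmod K) (P : extension N).
Local Notation M := (ext_tot P).
Local Notation U := (ext_ideal P).
Local Notation D := (xcomm (xfull_ideal M) (xfull_ideal M)).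
Variables (T : xideal M) (leTU : xsub_le T U) (leCT : xsub_le (pres_comm P) T).
Local Notation Q := (quot_ext leTU).

Lemma quot_ext_ideal : xsub_eq (ext_ideal Q) (xquot_sub T U).
Proof. exact: ximage_xsub_inc. Qed.

Lemma quot_ext_central : is_central_extension Q.
Proof.
have [br act act'] := (xcomm_leP U (xfull_ideal M) T).1 leCT.
have [eqt eqb] := quot_ext_ideal.
apply/is_central_extensionP; split.
- move=> x y; rewrite eqb => /in_imspace[p Up <-] _.
  have [q ->] := xquot_baseP y; have [l r] := br p q Up isT.
  by rewrite -!lhom_br !in_xzero_base !in_xquot_base.
- move=> x y; rewrite eqb => /in_imspace[p Up <-] _.
  have [n ->] := xquot_topP y; have [l r] := act p n Up isT.
  by rewrite -xhom_lact -xhom_ract !in_xzero_top !in_xquot_top.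
- move=> x y _; rewrite eqt => /in_imspace[n Un <-].
  have [q ->] := xquot_baseP x; have [l r] := act' q n isT Un.
  by rewrite -xhom_lact -xhom_ract !in_xzero_top !in_xquot_top.
Qed.

Hypothesis compl : xcomplement_mod (pres_comm P) T U D.

Lemma quot_ext_stem : is_stem_extension Q.
Proof.
split; first exact: quot_ext_central.
have [eqt eqb] := quot_ext_ideal; have [[sumt _] [sumb _]] := compl.
have [Dt Db] := xcomm_full_map (xproj T).
split=> x; rewrite ?eqt ?eqb => /in_imspace[u Uu <-].
  have [d /andP[_ Dd] Tud] := sumt u Uu.
  apply: Dt; apply/in_imspace; exists d => //.
  by apply/eqP; rewrite eq_sym -subr_eq0 -linearB /= in_xquot_top.
have [d /andP[_ Dd] Tud] := sumb u Uu.
apply: Db; apply/in_imspace; exists d => //.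
by apply/eqP; rewrite eq_sym -subr_eq0 -linearB /= in_xquot_base.
Qed.

(** The composite (U /\ D)/C -> M/C -> M/T is injective with image U/T, because T
    meets U /\ D inside C and U is (U /\ D) + T. *)
Lemma quot_ext_multiplier :
  xisomorphic (ext_ker Q) (xmod_of_sub (schur_multiplier P)).
Proof.
apply: xisomorphic_sym; have leC := le_xker_xproj leCT.
have [[sumt capt] [sumb capb]] := compl.
apply: (ximage_iso (f := subquot_map _ leC)).
  apply/subquot_map_injP; split=> d /andP[Dd]; rewrite in_kerspace.
    by rewrite in_xquot_top; apply: capt.
  by rewrite in_xquot_base; apply: capb.
have [imt imb] := subquot_map_image (xcap U D) leC.
split=> x; rewrite ?imt ?imb; apply/idP/idP => /in_imspace[u].
- by move=> /andP[Uu _] ux; apply/in_imspace; exists u.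
- move=> /sumt[d Dd Tud] <-; apply/in_imspace; exists d => //.
  by apply/eqP; rewrite eq_sym -subr_eq0 -linearB /= in_xquot_top.
- by move=> /andP[Uu _] ux; apply/in_imspace; exists u.
- move=> /sumb[d Dd Tud] <-; apply/in_imspace; exists d => //.
  by apply/eqP; rewrite eq_sym -subr_eq0 -linearB /= in_xquot_base.
Qed.

End ComplementGivesStemCover.

(** * Complements of the multiplier from stem covers *)

Section StemCoverGivesComplement.
Variables (K : fieldType) (N : xmod K) (P E : extension N).
Local Notation M := (ext_tot P).
Local Notation H := (ext_tot E).
Local Notation U := (ext_ideal P).
Local Notation A := (ext_ideal E).
Local Notation D := (xcomm (xfull_ideal M) (xfull_ideal M)).
Local Notation S := (xmod_of_sub (schur_multiplier P)).
Variable f : xhom M H.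
Hypotheses
  (f_top : forall n, xhom_top (ext_proj E) (xhom_top f n)
                     = xhom_top (ext_proj P) n)
  (f_base : forall q, xhom_base (ext_proj E) (xhom_base f q)
                      = xhom_base (ext_proj P) q).
Local Notation T := (xker_ideal f).

Lemma lift_ext_ideal_top n :
  (xhom_top f n \in xsub_top A) = (n \in xsub_top U).
Proof. by rewrite !ext_ideal_top f_top. Qed.

Lemma lift_ext_ideal_base q :
  (xhom_base f q \in xsub_base A) = (q \in xsub_base U).
Proof. by rewrite !ext_ideal_base f_base. Qed.

Lemma lift_ker_le : xsub_le T U.
Proof.
split=> x; rewrite in_kerspace => /eqP fx0.
  by rewrite -lift_ext_ideal_top fx0 rpred0.
by rewrite -lift_ext_ideal_base fx0 rpred0.
Qed.

Hypothesis E_stem : is_stem_extension E.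

(** f maps [U,M] into [A,H], which vanishes. *)
Lemma lift_pres_comm_le : xsub_le (pres_comm P) T.
Proof.
have [br act act'] := (is_central_extensionP E).1 E_stem.1.
apply/xcomm_leP; split.
- move=> p q; rewrite -lift_ext_ideal_base => Ap _.
  have [? ?] := br _ (xhom_base f q) Ap isT.
  by rewrite !in_kerspace !lhom_br.
- move=> q n; rewrite -lift_ext_ideal_base => Aq _.
  have [? ?] := act _ (xhom_top f n) Aq isT.
  by rewrite !in_kerspace xhom_lact xhom_ract.
- move=> q n _; rewrite -lift_ext_ideal_top => An.
  have [? ?] := act' (xhom_base f q) _ isT An.
  by rewrite !in_kerspace xhom_lact xhom_ract.
Qed.

Lemma lift_mod_kernel_top n : exists m, n - xhom_top f m \in xsub_top A.
Proof.
have [m mE] := (ext_proj_surj P).1 (xhom_top (ext_proj E) n).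
by exists m; rewrite ext_ideal_top linearB /= f_top mE subrr.
Qed.

Lemma lift_mod_kernel_base q : exists p, q - xhom_base f p \in xsub_base A.
Proof.
have [p pE] := (ext_proj_surj P).2 (xhom_base (ext_proj E) q).
by exists p; rewrite ext_ideal_base linearB /= f_base pE subrr.
Qed.

(** A lies in [H,H], which f reaches from D; a preimage of an element of A
    maps to 0 in N, so it lies in U as well. *)
Lemma stem_ideal_le_image : xsub_le A (ximage f (xcap U D)).
Proof.
have [central [At Ab]] := E_stem.
have [Dt Db] := xcomm_full_le_image ((is_central_extensionP E).1 central)
  lift_mod_kernel_top lift_mod_kernel_base.
split=> a Aa.
  have /in_imspace[d Dd da] := Dt _ (At _ Aa).
  apply/in_imspace; exists d => //; apply/andP; split=> //.
  by rewrite -lift_ext_ideal_top da.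
have /in_imspace[d Dd da] := Db _ (Ab _ Aa).
apply/in_imspace; exists d => //; apply/andP; split=> //.
by rewrite -lift_ext_ideal_base da.
Qed.

(** H is f(M) + A, and A is already in the image. *)
Lemma lift_surj : xsurjective f.
Proof.
have [At Ab] := stem_ideal_le_image; split=> y.
  have [m /At/in_imspace[d _ dE]] := lift_mod_kernel_top y.
  by exists (d + m); rewrite linearD /= dE subrK.
have [m /Ab/in_imspace[d _ dE]] := lift_mod_kernel_base y.
by exists (d + m); rewrite linearD /= dE subrK.
Qed.

Lemma stem_ideal_image : xsub_eq (ximage f (xcap U D)) A.
Proof.
have [At Ab] := stem_ideal_le_image.
split=> x; apply/idP/idP; [|exact: At| |exact: Ab].
  by move=> /in_imspace[d /andP[Ud _] <-]; rewrite lift_ext_ideal_top.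
by move=> /in_imspace[d /andP[Ud _] <-]; rewrite lift_ext_ideal_base.
Qed.

(** The map from the multiplier onto A becomes a surjective endomorphism of
    the finite-dimensional multiplier after composition with the isomorphism
    that a stem cover provides. *)
Lemma multiplier_map_inj :
    xfinite_dimensional S -> xisomorphic (ext_ker E) S ->
  xinjective (subquot_map (xcap U D) lift_pres_comm_le).
Proof.
move=> S_fd S_iso.
have [imt imb] := subquot_map_image (xcap U D) lift_pres_comm_le.
have [eqt eqb] := stem_ideal_image.
have [le1 le2] := xsub_eq_le
  (conj (fun x => etrans (imt x) (eqt x)) (fun x => etrans (imb x) (eqb x))
   : xsub_eq _ A).
have A_iso : xisomorphic (xmod_of_sub A) S.
  apply: xisomorphic_trans S_iso; apply: xisomorphic_sym.
  by apply: (ximage_iso (ext_inc_inj E)); split.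
have [injt injb] := xfd_surj_inj S_fd A_iso (xcorestrict_surj le1 le2).
split=> x y xy.
  by apply: injt; apply: val_inj.
by apply: injb; apply: val_inj.
Qed.

Lemma lift_complement :
    xinjective (subquot_map (xcap U D) lift_pres_comm_le) ->
  xcomplement_mod (pres_comm P) T U D.
Proof.
move=> /subquot_map_injP[capt capb]; have [At Ab] := stem_ideal_le_image.
split; split.
- move=> u; rewrite -lift_ext_ideal_top => /At/in_imspace[d Dd du].
  by exists d => //; rewrite in_kerspace linearB /= du subrr.
- by move=> d Dd Td; apply: capt; apply/andP.
- move=> u; rewrite -lift_ext_ideal_base => /Ab/in_imspace[d Dd du].
  by exists d => //; rewrite in_kerspace linearB /= du subrr.
- by move=> d Dd Td; apply: capb; apply/andP.
Qed.

Lemma lift_quot_iso :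
  xisomorphic H (xquot T) /\
  xisomorphic (ext_ker E) (xmod_of_sub (xquot_sub T U)).
Proof.
have le_refl : xsub_le T (xker f) by split.
pose fbar := xquot_lift le_refl.
have fbar_inj : xinjective fbar.
  apply: xinjective_ker; split=> x; rewrite in_kerspace.
    have [m ->] := xquot_topP x.
    by rewrite xquot_lift_topE => fm; apply/eqP; rewrite in_xquot_top.
  have [m ->] := xquot_baseP x.
  by rewrite xquot_lift_baseE => fm; apply/eqP; rewrite in_xquot_base.
have fbar_surj : xsurjective fbar.
  have [surjt surjb] := lift_surj; split=> y.
    have [m <-] := surjt y; exists (xhom_top (xproj T) m).
    exact: xquot_lift_topE.
  have [m <-] := surjb y; exists (xhom_base (xproj T) m).
  exact: xquot_lift_baseE.
split; first exact/xisomorphic_sym/(xbijective_iso fbar_inj fbar_surj).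
have [g [gt gtK gb gbK]] := xbijective_inverse fbar_inj fbar_surj.
have g_f n : xhom_top g (xhom_top f n) = xhom_top (xproj T) n.
  by rewrite -(xquot_lift_topE le_refl) gt.
have g_fb q : xhom_base g (xhom_base f q) = xhom_base (xproj T) q.
  by rewrite -(xquot_lift_baseE le_refl) gb.
have [surjt surjb] := lift_surj; have [incinjt incinjb] := ext_inc_inj E.
apply: (ximage_iso (f := xcomp g (ext_inc E))).
  split=> x y /=; [move=> /(can_inj gtK)|move=> /(can_inj gbK)].
    exact: incinjt.
  exact: incinjb.
split=> x; apply/idP/idP.
- move=> /in_imspace[a _ <-]; have [m mE] := surjt (xhom_top (ext_inc E) a).
  apply/in_imspace; exists m; last by rewrite /= -mE g_f.
  by rewrite -lift_ext_ideal_top mE; apply/in_imspace; exists a.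
- move=> /in_imspace[u]; rewrite -lift_ext_ideal_top => /in_imspace[a _ aE] <-.
  by apply/in_imspace; exists a => //; rewrite /= aE g_f.
- move=> /in_imspace[a _ <-]; have [m mE] := surjb (xhom_base (ext_inc E) a).
  apply/in_imspace; exists m; last by rewrite /= -mE g_fb.
  by rewrite -lift_ext_ideal_base mE; apply/in_imspace; exists a.
- move=> /in_imspace[u]; rewrite -lift_ext_ideal_base => /in_imspace[a _ aE] <-.
  by apply/in_imspace; exists a => //; rewrite /= aE g_fb.
Qed.

End StemCoverGivesComplement.

Theorem theorem4p5 (K : fieldType) (N : xmod K) (P : extension N)
    (P_free : is_free_xmod (ext_tot P)) :
  (forall (T : xideal (ext_tot P)) (leTU : xsub_le T (ext_ideal P)),
      xsub_le (pres_comm P) T ->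
      xdirect_sum (xquot_sub (pres_comm P) (ext_ideal P))
        (schur_multiplier P) (xquot_sub (pres_comm P) T) ->
    is_stem_cover P (quot_ext leTU))
  /\
  (forall E : extension N,
      xfinite_dimensional (xmod_of_sub (schur_multiplier P)) ->
      is_stem_cover P E ->
    exists T : xideal (ext_tot P),
      [/\ xsub_le (pres_comm P) T /\ xsub_le T (ext_ideal P),
          xdirect_sum (xquot_sub (pres_comm P) (ext_ideal P))
            (schur_multiplier P) (xquot_sub (pres_comm P) T),
          xisomorphic (ext_tot E) (xquot T) &
          xisomorphic (ext_ker E) (xmod_of_sub (xquot_sub T (ext_ideal P)))]).
Proof.
split=> [T leTU leCT /(xdirect_sum_quotP _ leCT leTU) compl|].
  by split; [apply: quot_ext_stem | apply: quot_ext_multiplier].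
move=> E S_fd [E_stem S_iso].
have [f [f_top f_base]] :=
  free_xmod_projective (ext_proj P) P_free (ext_proj_surj E).
have leCT := lift_pres_comm_le f_top f_base E_stem.
have leTU := lift_ker_le f_top f_base.
have [iso_tot iso_ker] := lift_quot_iso f_top f_base E_stem.
exists (xker_ideal f); split=> //.
apply/(xdirect_sum_quotP _ leCT leTU)/lift_complement.
exact: multiplier_map_inj.
Qed.
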